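(* Let $a,b$ be integers with $a\ge b\ge4$ and $5a\ge8b$. Then for every complex Hermitian positive-semidefinite matrix $A$ of order $a+b+6$, $$\overline d_{(a,b,3,3)}(A)\le\operatorname{per}(A).$$
   Context: For a partition $\lambda\vdash n$ let $\chi^\lambda$ be the corresponding irreducible character of the symmetric group $S_n$ and $f^\lambda=\chi^\lambda(1)$. For an $n\times n$ complex matrix $A=(a_{ij})$ define $d_\lambda(A)=\sum_{\sigma\in S_n}\chi^\lambda(\sigma)\prod_{i=1}^n a_{i,\sigma(i)}$, $\overline d_\lambda(A)=d_\lambda(A)/f^\lambda$, and $\operatorname{per}(A)=\sum_{\sigma\in S_n}\prod_i a_{i,\sigma(i)}$. *)

(* Defs.v *)
From HB Require Import structures.
From mathcomp Require Export all_boot all_order all_algebra all_fingroup.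
From mathcomp Require Export all_character.
From mathcomp Require Export complex reals.

Set Implicit Arguments.
Unset Strict Implicit.
Unset Printing Implicit Defensive.

Import Order.TTheory GRing.Theory Num.Theory.
Local Open Scope ring_scope.
Local Open Scope sesquilinear_scope.

(* A partition of n is given by the sequence la of its parts: nonincreasing,  *)
(* positive, with sum n. Its Young diagram carries the tableau in which       *)
(* 0, 1, ..., n - 1 are written row after row, so that the entry i is in row  *)
(* reshape_index la i and in column reshape_offset la i. The definitions      *)
(* below are meaningful only when la is a partition of n.                     *)

Definition is_partition (n : nat) (la : seq nat) : bool :=
  [&& sorted geq la, 0%N \notin la & sumn la == n].

Definition row_stab (n : nat) (la : seq nat) : {set 'S_n} :=
  [set s : 'S_n |
    [forall i : 'I_n, reshape_index la (s i) == reshape_index la i]].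

Definition col_stab (n : nat) (la : seq nat) : {set 'S_n} :=
  [set s : 'S_n |
    [forall i : 'I_n, reshape_offset la (s i) == reshape_offset la i]].

Section Specht.
Variables (F : fieldType) (n : nat) (la : seq nat).

(* Elements of the group algebra F[S_n] are row vectors: the group element s  *)
(* is the basis vector of index gring_index s.                                *)
Definition gring_elt (s : 'S_n) : 'rV[F]_#|[set: 'S_n]| :=
  delta_mx 0 (gring_index [set: 'S_n]%G s).

Definition young_symmetrizer : 'rV[F]_#|[set: 'S_n]| :=
  \sum_(p in row_stab n la) \sum_(q in col_stab n la)
    (-1) ^+ odd_perm q *: gring_elt (p * q)%g.

(* The ideal of F[S_n] generated by the Young symmetrizer. It is a right      *)
(* ideal because in MathComp s * t is "s, then t" and matrix representations  *)
(* act on row vectors from the right. With this convention la = [:: n] gives  *)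
(* the trivial representation and la = nseq n 1 the sign.                     *)
Definition specht_mx :=
  cyclic_mx (regular_repr F [set: 'S_n]%G) young_symmetrizer.

Definition specht_repr : mx_representation F [set: 'S_n]%G (\rank specht_mx) :=
  submod_repr (cyclic_mx_module (regular_repr F [set: 'S_n]%G)
                 young_symmetrizer).

Definition sym_char (s : 'S_n) : F := \tr (specht_repr s).

Definition immanant (A : 'M[F]_n) : F :=
  \sum_(s : 'S_n) sym_char s * \prod_(i < n) A i (s i).

Definition normalized_immanant (A : 'M[F]_n) : F :=
  immanant A / sym_char 1%g.

End Specht.

Definition permanent (F : fieldType) (n : nat) (A : 'M[F]_n) : F :=
  \sum_(s : 'S_n) \prod_(i < n) A i (s i).

(* In a numClosedFieldType, 0 <= z means that z is real and nonnegative.      *)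
Definition hermitian_psd (C : numClosedFieldType) (n : nat) (A : 'M[C]_n) :
    Prop :=
  A \is hermsymmx /\ forall v : 'cV[C]_n, 0 <= (v ^t* *m A *m v) 0 0.

Lemma is_partition_ab33 (a b : nat) :
  (b <= a)%N -> (4 <= b)%N -> is_partition (a + b + 6) [:: a; b; 3; 3]%N.
Proof.
case: b => // b ba b4; have a0 : (0 < a)%N by apply: leq_trans ba.
by rewrite /is_partition /= !inE ba (ltnW b4) /= addnA addn0 -addnA eqxx andbT; case: (a) a0.
Qed.

(* Main.v *)
(* Write A as the Gram matrix of vectors and attach to each vector a linear form in
   several groups of variables, the rows. With the Bombieri scalar product on
   polynomials, n! times the normalized immanant becomes an alternating sum, over
   column permutations q, of scalar products between products of these forms. The
   theorem follows from the chain
     (a, b, 3, 3) <= (a + b, 3, 3) <= (a + b + 3, 3) <= (a + b + 6),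
   where each step merges a row s into the row 0 above it.
   For one merge, let F be a product of forms in row 0 times the conjugate of the
   antisymmetrized product of the other rows, and let D_i contract row 0 with row i.
   The column permutations factor into exchanges of boxes with row 0, so the sum
   before the merge is, up to a common factor, the sum over k of
   (-1)^k / (k! a(a-1)...(a-k+1)) times the sum of ||D_I F||^2 over the words I of
   length k in the rows other than 0, a being the length of row 0. By Neuberger's
   identity the sum after the merge is the sum of ||D_s^k F||^2 / k!^2. Odd k only
   help, so it suffices that the sum of ||D_I F||^2 is at most binomial(a, k)
   ||D_s^k F||^2 for even k. Applying raising operators between row s and the rows
   below it to D_s^k F and comparing the resulting squared norms by a Casimir-type
   commutation relation and Cauchy-Schwarz reduces this to numerical inequalities,
   which hold for the three shapes above. *)
From HB Require Import structures.
Require Import Defs.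
From mathcomp Require Import ssrcomplements mpoly ring zify.
Set Implicit Arguments.
Unset Strict Implicit.
Unset Printing Implicit Defensive.
Import Order.TTheory GRing.Theory Num.Theory.
Local Open Scope ring_scope.

(** * Representations and Young symmetrizers *)

(** The conjugate in F is what produces norms. The scalar product factors over disjoint sets of
    variables, so the factors in the lower rows may change sides when conjugated; exchanging a box
    of row 0 with a lower box then becomes one contraction on each side, applied to the same F. The
    obstacle is that the sum before a merge contains contractions with every lower row, the sum
    after it only powers of D_s. The bridge is that the raising operator from row i to row s kills F
    and has commutator -D_i with D_s. Hence D_I D_s^m F is, up to a known nonzero factor, a word of
    raising operators applied to a higher power of D_s on F. Such words can be compared because the
    rows below s have one common length c: F is then killed by the polarizations between any two of
    them, and words longer than c vanish. *)

Section Fillings.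
Variables (n : nat) (row col : 'I_n -> nat) (len : nat -> nat).
Hypothesis box_inj : forall i j, row i = row j -> col i = col j -> i = j.
Hypothesis box_lt : forall i, (col i < len (row i))%N.
Hypothesis box_ex : forall i c, (c < len (row i))%N ->
  exists i', row i' = row i /\ col i' = c.

(** The columns in which the boxes of a row land are distinct; once they are known to lie within the
    length of the row, they fill it, and p i is the box of the row of i that lands in the column of
    i. This is the classical alternative for tableaux: unless two boxes of one row meet in one
    column, s is a row permutation times a column permutation. *)
Lemma transport_columns (s : 'S_n) :
  (forall i j, row i = row j -> col (s i) = col (s j) -> i = j) ->
  exists p : 'S_n, (forall i, row (p i) = row i)
                /\ (forall i, col (s (p i)) = col i).
Proof.
move=> sinj.
pose M := (\max_(i < n) row i).+1.
pose rw i : 'I_M := inord (row i).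
have rwE i j : rw i = rw j -> row i = row j.
  have lt k : (row k < M)%N by rewrite ltnS (leq_bigmax k).
  by move/(congr1 (@nat_of_ord _)); rewrite !inordK.
(* Otherwise, for L the length of the row of i, fewer boxes would be sent into
   the first L columns than there are boxes in them. *)
have col_lt i : (col (s i) < len (row i))%N.
  rewrite ltnNge; apply/negP => lei.
  set L := len (row i) in lei.
  have cardE : #|[set k | (col (s k) < L)%N]| = #|[set k | (col k < L)%N]|.
    rewrite -[RHS](card_preimset _ (@perm_inj _ s)); apply: eq_card => k.
    by rewrite !inE.
  have sumE (P : pred 'I_n) :
      #|[set k | P k]| = (\sum_(r < M) #|[set k | P k & rw k == r]|)%N.
    rewrite -sum1dep_card (partition_big rw predT) //=.
    by apply: eq_bigr => r _; rewrite sum1dep_card.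
  have le r : (#|[set k | (col (s k) < L)%N & rw k == r]|
               <= #|[set k | (col k < L)%N & rw k == r]|)%N.
    (* [bx] keeps the boxes of rows shorter than L and moves a box of any other row, within that
       row, to the column of its image; it is injective on the first set. *)
    pose bx k : 'I_n :=
      if (L <= len (row k))%N
      then odflt k [pick k' | (row k' == row k) && (col k' == col (s k))]
      else k.
    have bxP k : (col (s k) < L)%N -> (L <= len (row k))%N ->
        row (bx k) = row k /\ col (bx k) = col (s k).
      move=> lk Lk; rewrite /bx Lk; case: pickP => [k' /andP[/eqP-> /eqP->] //|no].
      have [k' [e1 e2]] := box_ex (leq_trans lk Lk).
      by have := no k'; rewrite /= e1 e2 !eqxx.
    rewrite -[leqLHS](@card_in_imset _ _ bx) => [|k k'].
      apply: subset_leq_card; apply/subsetP => y /imsetP[k kin ->].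
      move: kin; rewrite !inE => /andP[lk /eqP <-]; case: (leqP L (len (row k))) => [Lk|Lk].
        have [e1 e2] := bxP _ lk Lk; rewrite e2 lk; apply/eqP.
        by rewrite /rw e1.
      rewrite /bx (leqNgt L) Lk /= eqxx andbT.
      exact: leq_trans (box_lt k) (ltnW Lk).
    rewrite !inE => /andP[lk /eqP <-] /andP[lk' /eqP /rwE e].
    case: (leqP L (len (row k))) => [Lk|Lk].
      have [e1 e2] := bxP _ lk Lk; rewrite -e in Lk.
      have [] := bxP _ lk' _; first by rewrite e in Lk *.
      move=> e1' e2' eb; apply: sinj; first by rewrite e.
      by rewrite -e2 -e2' eb.
    by rewrite /bx e (leqNgt L) Lk.
  have /eqP := cardE; rewrite (sumE (fun k => col k < L)%N).
  rewrite (sumE (fun k => col (s k) < L)%N); apply/negP.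
  rewrite neq_ltn; apply/orP; left.
  rewrite [X in (X < _)%N](bigD1 (rw i)) // [X in (_ < X)%N](bigD1 (rw i)) //=.
  rewrite -addSn; apply: leq_add; last by apply: leq_sum => r _; apply: le.
  apply: proper_card; apply/properP; split.
    apply/subsetP => k; rewrite !inE => /andP[_ /eqP e]; rewrite e eqxx andbT.
    by rewrite /L -(rwE _ _ e) box_lt.
  by exists i; rewrite !inE eqxx ?box_lt // andbT -leqNgt.
have ex i : exists k, (row k == row i) && (col (s k) == col i).
  apply/existsP; apply: contraT; rewrite negb_exists => /forallP no.
  pose cs (k : 'I_n) := odflt k
    [pick k' | (row k' == row k) && (col k' == col (s k))].
  have csP k : row (cs k) = row k /\ col (cs k) = col (s k).
    rewrite /cs; case: pickP => [k' /andP[/eqP-> /eqP->] //|no'].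
    have [k' [e1 e2]] := box_ex (col_lt k).
    by have := no' k'; rewrite /= e1 e2 !eqxx.
  have cs_inj : injective cs.
    move=> k k' e; have [e1 e2] := csP k; have [e1' e2'] := csP k'.
    by apply: sinj; rewrite -?e1 -?e2 -?e1' -?e2' e.
  have := no (invF cs_inj i); have [e1 e2] := csP (invF cs_inj i).
  by rewrite -e1 -e2 f_invF !eqxx.
pose f i := xchoose (ex i).
have fP i : row (f i) = row i /\ col (s (f i)) = col i.
  by have /andP[/eqP ? /eqP ?] := xchooseP (ex i).
have f_inj : injective f.
  move=> i j e; have [e1 e2] := fP i; have [e1' e2'] := fP j.
  by apply: box_inj; rewrite -?e1 -?e2 -?e1' -?e2' e.
by exists (perm f_inj); split=> i; rewrite permE; case: (fP i).
Qed.

End Fillings.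

Lemma trace_cyclic_submod (F : fieldType) (gT : finGroupType)
    (G : {group gT}) m (rG : mx_representation F G m) (u : 'rV_m) (c : F)
    (L : 'M_m) (x : gT) :
    (L :=: cyclic_mx rG u)%MS -> L *m L = c *: L -> x \in G ->
  c * \tr (submod_repr (cyclic_mx_module rG u) x) = \tr (rG x *m L).
Proof.
(* L is c times a projection onto the cyclic submodule. *)
move=> eqL LL Gx; set U := cyclic_mx rG u.
have modU := cyclic_mx_module rG u; pose V := val_submod (1%:M : 'M_(\rank U)).
pose D := in_submod U L.
have DV : D *m V = L by rewrite -val_submodE in_submodK // eqL.
have VL : V *m L = c *: V.
  have /submxP[W ->] : (V <= L)%MS by rewrite eqL val_submod1.
  by rewrite -mulmxA LL scalemxAr.
have VD : V *m D = c%:M.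
  apply: (@val_submod_inj _ _ U); rewrite val_submodE -/V -mulmxA DV VL.
  by rewrite val_submodE -/V mul_scalar_mx.
have SV : submod_repr modU x *m V = V *m rG x.
  by rewrite -val_submodE -[X in val_submod X]mul1mx /= val_submodJ.
transitivity (\tr (submod_repr modU x *m V *m D)).
  by rewrite -mulmxA VD mul_mx_scalar mxtraceZ.
by rewrite SV -mulmxA mxtrace_mulC -mulmxA DV.
Qed.

Lemma big_mulgl (gT : finGroupType) (K : {group gT}) (V : nmodType)
    (f : gT -> V) x : x \in K -> \sum_(y in K) f y = \sum_(y in K) f (x * y)%g.
Proof.
move=> Kx; rewrite (reindex_inj (mulgI x)) /=.
by apply: eq_bigl => y; rewrite groupMl.
Qed.

Lemma big_mulgr (gT : finGroupType) (K : {group gT}) (V : nmodType)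
    (f : gT -> V) x : x \in K -> \sum_(y in K) f y = \sum_(y in K) f (y * x)%g.
Proof.
move=> Kx; rewrite (reindex_inj (mulIg x)) /=.
by apply: eq_bigl => y; rewrite groupMr.
Qed.

Lemma big_invg (gT : finGroupType) (K : {group gT}) (V : nmodType)
    (f : gT -> V) : \sum_(y in K) f y = \sum_(y in K) f y^-1%g.
Proof.
rewrite (reindex_inj invg_inj) /=.
by apply: eq_bigl => y; rewrite groupV.
Qed.

Section YoungSymmetrizer.
Variables (F : numFieldType) (n : nat) (la : seq nat).
Hypothesis la_n : sumn la = n.

Let rw (i : 'I_n) := reshape_index la i.
Let cl (i : 'I_n) := reshape_offset la i.
Let R := row_stab n la.
Let C := col_stab n la.
Let e (s : 'S_n) : 'rV[F]_#|[set: 'S_n]| := gring_elt F s.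
Let rG := regular_repr F [set: 'S_n]%G.
Let c : 'rV[F]_#|[set: 'S_n]| := young_symmetrizer F n la.
Let sg (s : 'S_n) : F := (-1) ^+ odd_perm s.

Lemma box_inj i j : rw i = rw j -> cl i = cl j -> i = j.
Proof.
move=> er ec; apply: val_inj; rewrite /= -(reshape_indexK la i).
by rewrite -(reshape_indexK la j) -/(rw i) -/(rw j) -/(cl i) -/(cl j) er ec.
Qed.

Lemma box_lt i : (cl i < nth 0%N la (rw i))%N.
Proof. by apply: reshape_offsetP; rewrite la_n. Qed.

Lemma box_ex r k : (k < nth 0%N la r)%N ->
  exists i, rw i = r /\ cl i = k.
Proof.
move=> lt; have := flatten_indexP lt; rewrite la_n => lt'.
by exists (Ordinal lt'); rewrite /rw /cl /= flatten_indexKl ?flatten_indexKr.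
Qed.

Lemma row_stabP (s : 'S_n) : reflect (forall i, rw (s i) = rw i) (s \in R).
Proof. by rewrite inE; apply: (iffP forallP) => h i; exact/eqP/h. Qed.

Lemma col_stabP (s : 'S_n) : reflect (forall i, cl (s i) = cl i) (s \in C).
Proof. by rewrite inE; apply: (iffP forallP) => h i; exact/eqP/h. Qed.

Lemma row_stab_group : group_set R.
Proof.
apply/group_setP; split=> [|s t /row_stabP hs /row_stabP ht].
  by apply/row_stabP => i; rewrite perm1.
by apply/row_stabP => i; rewrite permM ht hs.
Qed.

Lemma col_stab_group : group_set C.
Proof.
apply/group_setP; split=> [|s t /col_stabP hs /col_stabP ht].
  by apply/col_stabP => i; rewrite perm1.
by apply/col_stabP => i; rewrite permM ht hs.
Qed.

Let Rg := Group row_stab_group.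
Let Cg := Group col_stab_group.

Let sgM s t : sg (s * t)%g = sg s * sg t.
Proof. by rewrite /sg odd_permM signr_addb. Qed.

Let sgV s : sg s^-1%g = sg s.
Proof. by rewrite /sg odd_permV. Qed.

Let sgK s : sg s * sg s = 1.
Proof. by rewrite /sg -signr_addb addbb. Qed.

Let eM s t : e s *m rG t = e (s * t)%g.
Proof.
by rewrite /e /gring_elt -rowE /= /regular_mx rowK gring_indexK ?inE.
Qed.

Let sandwich s := \sum_(p in R) \sum_(q in C) sg q *: e (p * s * q)%g.

(** Von Neumann's lemma. If boxes i, j of one row land in one column, their transposition is
    absorbed by the row group and its conjugate by the column group with a sign, so the sandwich
    equals its negative. Otherwise s is a row permutation times a column permutation, and both are
    absorbed. *)
Lemma sandwichE s : exists z, sandwich s = z *: c.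
Proof.
have [/existsP[i /existsP[j /and3P[ij /eqP er /eqP ec]]]|] := boolP
    [exists i, [exists j, [&& i != j, rw i == rw j & cl (s i) == cl (s j)]]].
  exists 0; rewrite scale0r.
  have tR : tperm i j \in R.
    by apply/row_stabP => k; case: tpermP => [->|->|]; rewrite ?er.
  have tC : (tperm i j ^ s)%g \in C.
    rewrite tpermJ.
    by apply/col_stabP => k; case: tpermP => [->|->|]; rewrite ?ec.
  have eqN : sandwich s = - sandwich s.
    rewrite {1}/sandwich (big_mulgr (K := Rg) _ tR) -sumrN; apply: eq_bigr => p _.
    rewrite (big_mulgl (K := Cg) _ tC) -sumrN; apply: eq_bigr => q _.
    rewrite sgM {1}/sg odd_permJ odd_tperm (eqP _ : (i != j) = true) ?ij //=.
    rewrite expr1 mulN1r scaleNr; congr (- (_ *: e _)).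
    by rewrite !mulgA mulgK -(mulgA p) tperm2 mulg1.
  apply/eqP; have /eqP := eqN; rewrite -addr_eq0 -mulr2n -scaler_nat.
  by rewrite scaler_eq0 pnatr_eq0.
rewrite negb_exists => /forallP no.
have [|p [p1 p2]] := transport_columns box_inj box_lt (fun i k => @box_ex (rw i) k) (s := s).
  move=> i j er ec; apply/eqP; move: (no i); rewrite negb_exists => /forallP/(_ j).
  by rewrite er ec !eqxx !andbT negbK.
have pR : p \in Rg by apply/row_stabP.
have psC : (p * s)%g \in Cg by apply/col_stabP => i; rewrite permM p2.
exists (sg (p * s)%g); rewrite /sandwich (big_mulgr (K := Rg) _ pR).
rewrite /c /young_symmetrizer scaler_sumr; apply: eq_bigr => p' _.
rewrite -(groupV Cg) in psC; rewrite (big_mulgl (K := Cg) _ psC) scaler_sumr.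
apply: eq_bigr => q _; rewrite scalerA; congr (_ *: e _).
  by rewrite {1}/sg odd_permM odd_permV signr_addb.
by rewrite -!mulgA; congr (_ * _)%g; rewrite invMg !mulgA mulgK mulgV mul1g.
Qed.

(** Left multiplication by the symmetrizer, as a matrix acting on row vectors from the right; it
    commutes with the regular representation and its image is the ideal. *)
Let L := \matrix_(i < #|[set: 'S_n]|) (c *m rG (enum_val i)).

Lemma young_symmetrizerE : c = \sum_(p in R) \sum_(q in C) sg q *: e (p * q)%g.
Proof. by []. Qed.

Lemma gring_elt_mul s : e s *m L = c *m rG s.
Proof. by rewrite /e /gring_elt -rowE rowK gring_indexK ?inE. Qed.

Lemma young_symmetrizer_quasi_idem : exists z, c *m L = z *: c.
Proof.
have [z zP] : exists z : 'S_n -> F, forall s, sandwich s = z s *: c.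
  by apply: (fin_all_exists sandwichE).
exists (\sum_(p in R) \sum_(q in C) sg q * z (q * p)%g).
rewrite {1}young_symmetrizerE mulmx_suml scaler_suml.
transitivity (\sum_(p in R) \sum_(q in C) \sum_(p' in R) \sum_(q' in C)
   (sg q * sg q') *: e (p' * (q' * p) * q)%g).
  apply: eq_bigr => p _; rewrite mulmx_suml; apply: eq_bigr => q _.
  rewrite -scalemxAl gring_elt_mul young_symmetrizerE mulmx_suml scaler_sumr.
  apply: eq_bigr => p' _; rewrite mulmx_suml scaler_sumr; apply: eq_bigr => q' _.
  by rewrite -scalemxAl eM scalerA !mulgA.
apply: eq_bigr => p _; rewrite exchange_big /= scaler_suml.
transitivity (\sum_(p' in R) \sum_(q' in C) \sum_(q in C)
   (sg q * sg q') *: e (p' * (q' * p) * q)%g).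
  by apply: eq_bigr => p' _; rewrite exchange_big.
rewrite exchange_big /=; apply: eq_bigr => q' _.
rewrite -scalerA -zP scaler_sumr; apply: eq_bigr => p' _.
by rewrite scaler_sumr; apply: eq_bigr => q _; rewrite scalerA mulrC.
Qed.

Lemma mul_young_cyclic : (L :=: cyclic_mx rG c)%MS.
Proof.
apply: eqmx_trans (eqmx_sym (genmxE _)); rewrite (_ : _ *m _ = L) //.
apply/row_matrixP => i; rewrite row_mul rowK rowK.
by rewrite mul_rV_lin1 /= mxvecK.
Qed.

Lemma mul_young_comm s : rG s *m L = L *m rG s.
Proof.
apply/row_matrixP => j; rewrite !row_mul [row j L]rowK -mulmxA.
rewrite -repr_mxM ?inE // [row j _](_ : _ = e (enum_val j * s)%g) ?gring_elt_mul //.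
by rewrite /= /regular_mx rowK.
Qed.

(** Both sides are the trace of u -> c u s on the group algebra. Since L is z times a projection
    onto the ideal, this is z times the character; in the basis of permutations it is a signed count
    of fixed points. *)
Lemma trace_sym_char z : c *m L = z *: c -> forall s,
  z * sym_char F la s = \sum_g \sum_(p in R) \sum_(q in C)
     sg q * ((p * q * (g * s))%g == g)%:R.
Proof.
move=> cL s; rewrite /sym_char /specht_repr.
rewrite (trace_cyclic_submod mul_young_cyclic) ?inE //; last first.
  apply/row_matrixP => i; rewrite row_mul rowK linearZ /= rowK scalemxAl -cL.
  by rewrite -!mulmxA mul_young_comm.
rewrite /mxtrace (reindex (fun g : 'S_n => gring_index [set: 'S_n]%G g)) /=; last first.
  by exists enum_val => i _; rewrite ?gring_valK ?gring_indexK ?inE.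
apply: eq_bigr => g _.
set k := gring_index _ g; transitivity (row k (L *m rG s) 0 k).
  by rewrite -mul_young_comm !mxE.
rewrite row_mul rowK gring_indexK ?inE // -mulmxA -repr_mxM ?inE //.
rewrite young_symmetrizerE mulmx_suml summxE; apply: eq_bigr => p _.
rewrite mulmx_suml summxE; apply: eq_bigr => q _.
rewrite -scalemxAl mxE eM /e /gring_elt mxE eqxx /= [in LHS]eq_sym.
by rewrite (inj_in_eq (can_in_inj (@gring_indexK _ _))) ?inE.
Qed.

(** The unknown z cancels in the quotient by the degree: at the identity only p = q = 1 contributes
    to the trace, so z times the degree is n!. In the remaining sum s is forced to be a conjugate of
    a product of p and q by g. *)
Lemma normalized_immanantE (A : 'M[F]_n) :
  normalized_immanant la A * n`!%:R =
  \sum_(g : 'S_n) \sum_(p in R) \sum_(q in C)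
     sg q * \prod_i A (g i) (g (q (p i))).
Proof.
have [z cL] := young_symmetrizer_quasi_idem.
have tr := trace_sym_char cL.
have RC1 p : p \in R -> p \in C -> p = 1%g.
  move=> /row_stabP pR /col_stabP pC; apply/permP => i.
  by rewrite perm1; apply: box_inj.
have z1 : z * sym_char F la (1 : 'S_n)%g = n`!%:R.
  rewrite tr (eq_bigr (fun _ => 1)) => [|g _].
    by rewrite sumr_const card_Sn.
  have pq1 p q : (p * q * (g * 1) == g)%g = (p == q^-1)%g.
    by rewrite mulg1 -[X in _ == X]mul1g (inj_eq (mulIg g)) [RHS]eq_mulgV1 invgK.
  rewrite (bigD1 1%g) ?(group1 Rg) //= (bigD1 1%g) ?(group1 Cg) //=.
  rewrite pq1 invg1 eqxx mulr1 /sg odd_perm1 expr0.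
  rewrite !big1 ?addr0 // => [p /andP[Rp /negPf p1]|q /andP[Cq /negPf q1]].
    rewrite big1 // => q Cq; rewrite pq1; case: eqP => [pE|_]; last by rewrite mulr0.
    have p_1 : p = 1%g by apply: RC1 => //; rewrite pE (groupV Cg).
    by rewrite p_1 eqxx in p1.
  by rewrite pq1 eq_sym -(inj_eq invg_inj) invgK invg1 q1 mulr0.
have zN0 : z != 0.
  by apply: contraTneq (fact_gt0 n) => z0; rewrite -(ltr0n F) -z1 z0 mul0r ltxx.
have c1N0 : sym_char F la (1 : 'S_n)%g != 0.
  by apply: contraTneq (fact_gt0 n) => z0; rewrite -(ltr0n F) -z1 z0 mulr0 ltxx.
rewrite /normalized_immanant -z1 mulrCA -[_ / _ * _]mulrA mulVf // mulr1.
rewrite /immanant mulr_sumr.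
under eq_bigr => s _ do rewrite mulrA tr mulr_suml.
rewrite exchange_big /=.
transitivity (\sum_(g : 'S_n) \sum_(p in R) \sum_(q in C)
     sg q * \prod_i A (g i) (g (p (q i)))).
  apply: eq_bigr => g _.
  under eq_bigr => s _ do rewrite mulr_suml.
  rewrite exchange_big (big_invg Rg) /=; apply: eq_bigr => p _.
  under eq_bigr => s _ do rewrite mulr_suml.
  rewrite exchange_big (big_invg Cg) /=; apply: eq_bigr => q _.
  rewrite (bigD1 ((q * p) ^ g)%g) //= [X in _ + X]big1 => [|s /negPf sN].
    have -> : (p^-1 * q^-1 * (g * (q * p) ^ g))%g = g.
      by rewrite -conjgC mulgA -invMg mulVg mul1g.
    rewrite eqxx addr0 mulr1 sgV (reindex_inj (@perm_inj _ g)) /=.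
    by congr (_ * _); apply: eq_bigr => i _; rewrite permJ permM.
  case: eqP => [|_]; last by rewrite mulr0 mul0r.
  move=> E; suff : s = ((q * p) ^ g)%g by move/eqP; rewrite sN.
  apply: (mulgI g); rewrite -conjgC; apply: (mulgI (p^-1 * q^-1)%g).
  by rewrite E [RHS]mulgA -invMg mulVg mul1g.
rewrite exchange_big [RHS]exchange_big /=; apply: eq_bigr => p _.
rewrite exchange_big [RHS]exchange_big /=; apply: eq_bigr => q _.
rewrite (reindex_inj (mulgI q)) /=; apply: eq_bigr => g _; congr (_ * _).
rewrite (reindex_inj (@perm_inj _ q^-1)%g) /=.
by apply: eq_bigr => i _; rewrite !permM permKV.
Qed.
End YoungSymmetrizer.

(** * The Bombieri inner product *)

Section Bombieri.
Variables (C : numClosedFieldType) (m : nat).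
Implicit Types (p q u v : {mpoly C[m]}) (k l : 'X_{1..m}).

Definition mfact k : nat := \prod_(i < m) (k i)`!.

(* The Bombieri form, for which multiplication by a variable is adjoint to
   differentiation. *)
Definition dot p q : C :=
  \sum_(k <- msupp p) p@_k * (q@_k)^* * (mfact k)%:R.

Lemma dotwE d p q : (msize p <= d)%N ->
  dot p q = \sum_(k : 'X_{1..m < d}) p@_k * (q@_k)^* * (mfact k)%:R.
Proof.
move=> le_pd; rewrite /dot (big_mksub 'X_{1..m < d}) /=; first last.
  by move=> x /msize_mdeg_lt/leq_trans/(_ le_pd).
  by rewrite msupp_uniq.
by rewrite big_rmcond //= => j /memN_msupp_eq0 ->; rewrite !mul0r.
Qed.

Lemma dotZDl c p q u : dot (c *: p + q) u = c * dot p u + dot q u.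
Proof.
pose d := maxn (msize (c *: p + q)) (maxn (msize p) (msize q)).
rewrite !(@dotwE d) ?leq_max ?leqnn ?orbT //.
rewrite mulr_sumr -big_split; apply: eq_bigr => k _.
by rewrite mcoeffD mcoeffZ !mulrDl !mulrA.
Qed.

Lemma dotC p q : dot q p = (dot p q)^*.
Proof.
pose d := maxn (msize p) (msize q).
rewrite !(@dotwE d) ?leq_max ?leqnn ?orbT // rmorph_sum.
apply: eq_bigr => k _; rewrite !rmorphM /= conjCK rmorph_nat.
by rewrite [q@_k * _]mulrC.
Qed.

Lemma dot0l q : dot 0 q = 0.
Proof. by rewrite /dot msupp0 big_nil. Qed.

Lemma dotDl p q u : dot (p + q) u = dot p u + dot q u.
Proof. by rewrite -{1}[p]scale1r dotZDl mul1r. Qed.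

Lemma dotZl c p u : dot (c *: p) u = c * dot p u.
Proof. by rewrite -[c *: p]addr0 dotZDl dot0l addr0. Qed.

Lemma dotNl p u : dot (- p) u = - dot p u.
Proof. by rewrite -scaleN1r dotZl mulN1r. Qed.

Lemma dot0r q : dot q 0 = 0.
Proof. by rewrite dotC dot0l conjC0. Qed.

Lemma dotDr p q u : dot u (p + q) = dot u p + dot u q.
Proof. by rewrite dotC dotDl rmorphD /= -!dotC. Qed.

Lemma dotZr c p u : dot u (c *: p) = c^* * dot u p.
Proof. by rewrite dotC dotZl rmorphM /= -dotC. Qed.

Lemma dotNr p u : dot u (- p) = - dot u p.
Proof. by rewrite -scaleN1r dotZr rmorphN1 mulN1r. Qed.

Lemma dot_suml I (r : seq I) (P : pred I) (f : I -> {mpoly C[m]}) u :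
  dot (\sum_(i <- r | P i) f i) u = \sum_(i <- r | P i) dot (f i) u.
Proof. by apply: (big_morph (dot^~ u)) => [p q|]; rewrite ?dotDl ?dot0l. Qed.

Lemma dot_sumr I (r : seq I) (P : pred I) (f : I -> {mpoly C[m]}) u :
  dot u (\sum_(i <- r | P i) f i) = \sum_(i <- r | P i) dot u (f i).
Proof. by apply: (big_morph (dot u)) => [p q|]; rewrite ?dotDr ?dot0r. Qed.

Lemma mfact_gt0 k : 0 < (mfact k)%:R :> C.
Proof. by rewrite ltr0n prodn_gt0 // => i; apply: fact_gt0. Qed.

Lemma dot_ge0 p : 0 <= dot p p.
Proof.
rewrite /dot; apply: sumr_ge0 => k _.
by rewrite mulr_ge0 ?mul_conjC_ge0 ?(ltW (mfact_gt0 _)).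
Qed.

Lemma dot_eq0 p : dot p p = 0 -> p = 0.
Proof.
move=> /eqP; rewrite /dot psumr_eq0 => [/allP h|k _]; last first.
  by rewrite mulr_ge0 ?mul_conjC_ge0 ?(ltW (mfact_gt0 _)).
apply/mpolyP => k; rewrite mcoeff0; apply/eqP/contraT => pk.
have := h k; rewrite mcoeff_msupp pk => /(_ isT) /=.
by rewrite mulf_eq0 mul_conjC_eq0 (negPf pk) (gt_eqF (mfact_gt0 _)).
Qed.

Lemma dotXX k l : dot 'X_[k] 'X_[l] = (k == l)%:R * (mfact k)%:R.
Proof.
rewrite /dot msuppX big_seq1 !mcoeffX eqxx mul1r.
by rewrite eq_sym conjC_nat.
Qed.

Lemma mfactD1 k i : mfact (k + U_(i)) = ((k i).+1 * mfact k)%N.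
Proof.
rewrite /mfact (bigD1 i) //= [in RHS](bigD1 i) //= mulnA.
congr (_ * _)%N; first by rewrite mnmDE mnm1E eqxx addn1 factS.
by apply: eq_bigr => j ji; rewrite mnmDE mnm1E eq_sym (negPf ji) addn0.
Qed.

Lemma dot_mulX i p q : dot ('X_i * p) q = dot p q^`M(i).
Proof.
elim/mpolyind: p => [|c k p _ _ IH]; first by rewrite mulr0 !dot0l.
rewrite mulrDr dotDl IH -scalerAr dotZl dotDl dotZl; congr (_ * _ + _); clear IH.
elim/mpolyind: q => [|d l q _ _ IHq]; first by rewrite mderiv0 !dot0r.
rewrite mderivD mderivZ !dotDr IHq !dotZr; congr (_ * _ + _).
rewrite -mpolyXD dotXX mderivX dotZr dotXX conjC_nat addmC.
have [e|ne] := eqVneq (k + U_(i))%MM l.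
  rewrite -e mnmDE mnm1E eqxx addn1 mfactD1 addmK eqxx natrM !mul1r //.
rewrite mul0r; have [l0|l0] := eqVneq (l i) 0%N; first by rewrite l0 mul0r.
rewrite (_ : (k == _) = false) ?mul0r ?mulr0 //.
apply: contraNF ne => /eqP ->; rewrite submK //.
by rewrite lep1mP.
Qed.

Lemma dot_mulXr i p q : dot p ('X_i * q) = dot p^`M(i) q.
Proof. by rewrite dotC dot_mulX -dotC. Qed.

Lemma dot11 : dot 1 1 = 1.
Proof.
by rewrite -mpolyX0 dotXX eqxx mul1r /mfact big1 // => i; rewrite mnm0E.
Qed.

Definition cj p : {mpoly C[m]} := map_mpoly (@Num.conj C) p.

Lemma cj0 : cj 0 = 0.
Proof. exact: raddf0. Qed.

Lemma cjM p q : cj (p * q) = cj p * cj q.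
Proof. exact: rmorphM. Qed.

Lemma cjZ c p : cj (c *: p) = c^* *: cj p.
Proof. exact: map_mpolyZ. Qed.

Lemma cjX i : cj 'X_i = 'X_i.
Proof. exact: map_mpolyX. Qed.

Lemma cj_deriv i p : cj p^`M(i) = (cj p)^`M(i).
Proof.
apply/mpolyP => k; rewrite mcoeff_deriv !mcoeff_map_mpoly mcoeff_deriv.
exact: raddfMn.
Qed.

Lemma cj_sum I (r : seq I) (P : pred I) (f : I -> {mpoly C[m]}) :
  cj (\sum_(i <- r | P i) f i) = \sum_(i <- r | P i) cj (f i).
Proof. exact: raddf_sum. Qed.

Lemma dot_cj p q : dot (cj p) (cj q) = dot q p.
Proof.
rewrite dotC; pose d := maxn (msize p) (maxn (msize q) (msize (cj q))).
rewrite !(@dotwE d) ?leq_max ?leqnn ?orbT // rmorph_sum.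
apply: eq_bigr => k _; rewrite !mcoeff_map_mpoly !rmorphM /= conjCK !conjCK.
by rewrite conjC_nat.
Qed.

Section Split.
Variable z : pred 'I_m.

(** Only variables of [z] occur in p; in characteristic 0 vanishing derivatives express this. *)
Definition inside p := forall i, ~~ z i -> p^`M(i) = 0.
Definition outside p := forall i, z i -> p^`M(i) = 0.

Lemma deriv_eq0_msupp i p k : p^`M(i) = 0 -> k \in msupp p -> k i = 0%N.
Proof.
move=> d0; rewrite mcoeff_msupp; apply: contraNeq => ki.
have : (p^`M(i))@_(k - U_(i)) = 0 by rewrite d0 mcoeff0.
rewrite mcoeff_deriv submK ?lep1mP // => /eqP.
by rewrite mulrn_eq0 /=.
Qed.

Lemma mfact_split k l :
    (forall i, ~~ z i -> k i = 0%N) -> (forall i, z i -> l i = 0%N) ->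
  mfact (k + l) = (mfact k * mfact l)%N.
Proof.
move=> hk hl; rewrite /mfact -big_split; apply: eq_bigr => i _ /=.
rewrite mnmDE; case zi : (z i); first by rewrite hl // addn0 muln1.
by rewrite hk ?zi // mul1n.
Qed.

Lemma dot_split p q u v : inside p -> inside u -> outside q -> outside v ->
  dot (p * q) (u * v) = dot p u * dot q v.
Proof.
move=> hp hu hq hv.
rewrite [p]mpolyE [q]mpolyE [u]mpolyE [v]mpolyE.
rewrite [X in dot X _]mulr_suml [X in dot _ X]mulr_suml.
rewrite !dot_suml mulr_suml; apply: eq_big_seq => k kp.
rewrite !dot_sumr mulr_suml; apply: eq_big_seq => k' ku.
rewrite !mulr_sumr !dot_suml; apply: eq_big_seq => l lq.
rewrite !dot_sumr mulr_sumr; apply: eq_big_seq => l' lv.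
rewrite -!scalerAl -!scalerAr !dotZl !dotZr -!mpolyXD !dotXX.
have k0 i : ~~ z i -> k i = 0%N by move/hp/deriv_eq0_msupp; apply.
have k'0 i : ~~ z i -> k' i = 0%N by move/hu/deriv_eq0_msupp; apply.
have l0 i : z i -> l i = 0%N by move/hq/deriv_eq0_msupp; apply.
have l'0 i : z i -> l' i = 0%N by move/hv/deriv_eq0_msupp; apply.
rewrite mfact_split // natrM.
have -> : (k + l == k' + l')%MM = (k == k') && (l == l').
  apply/eqP/andP => [/mnmP e|[/eqP-> /eqP->] //].
  split; apply/eqP/mnmP => i; have := e i; rewrite !mnmDE; case zi : (z i).
  - by rewrite l0 ?l'0 // !addn0.
  - by rewrite k0 ?k'0 ?zi.
  - by rewrite l0 ?l'0.
  - by rewrite k0 ?k'0 ?zi // !add0n.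
case: (k == k'); case: (l == l'); rewrite /= ?mul0r ?mul1r ?mulr0 ?mul0r ?mulr0 //.
by ring.
Qed.

(** Both sides factor over the two sets of variables, and conjugating q and v exchanges their places
    in the second factor. *)
Lemma dot_partial_transpose p q u v :
    inside p -> inside u -> outside q -> outside v ->
  dot (p * q) (u * v) = dot (p * cj v) (u * cj q).
Proof.
have cj_out w : outside w -> outside (cj w).
  by move=> hw i zi; rewrite -cj_deriv hw // cj0.
by move=> hp hu hq hv; rewrite !dot_split ?dot_cj //; apply: cj_out.
Qed.

End Split.
End Bombieri.

(** * Polarization and contraction operators *)

Section RowVariables.
Variables (C : numClosedFieldType) (r N : nat).

Definition rvar (i : 'I_r.+1) (c : 'I_N) : 'I_#|{: 'I_r.+1 * 'I_N}| :=
  enum_rank (i, c).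

Local Notation P := {mpoly C[#|{: 'I_r.+1 * 'I_N}|]}.
Implicit Types (p q u v : P) (i j k l : 'I_r.+1) (a : 'I_N -> C).

Definition rX i c : P := 'X_(rvar i c).
Definition rd i c p : P := p^`M(rvar i c).

Lemma rd_is_linear i c : linear (rd i c).
Proof. exact: mderiv_is_linear. Qed.
HB.instance Definition _ i c :=
  GRing.isLinear.Build C P P _ (rd i c) (rd_is_linear i c).

Lemma rdM i c p q : rd i c (p * q) = rd i c p * q + p * rd i c q.
Proof. exact: mderivM. Qed.

Lemma rd1 i c : rd i c 1 = 0.
Proof. exact: mderivC. Qed.

Lemma rdC i c j e p : rd i c (rd j e p) = rd j e (rd i c p).
Proof. exact: mderiv_comm. Qed.

Lemma rd_rX i c j e : rd i c (rX j e) = ((i == j) && (c == e))%:R.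
Proof.
rewrite /rd /rX mderivX mnm1E (inj_eq enum_rank_inj) xpair_eqE.
rewrite [in LHS](eq_sym j) [in LHS](eq_sym e).
case: eqP => [->|_]; last by rewrite scale0r.
case: eqP => [->|_]; last by rewrite scale0r.
rewrite scale1r (_ : (U_(_) - U_(_))%MM = 0%MM) ?mpolyX0 //.
by apply/mnmP => x; rewrite mnmBE subnn mnm0E.
Qed.

Lemma dot_rX i c p q : dot (rX i c * p) q = dot p (rd i c q).
Proof. exact: dot_mulX. Qed.

Lemma dot_rXr i c p q : dot p (rX i c * q) = dot (rd i c p) q.
Proof. exact: dot_mulXr. Qed.

(* Polarization from row j to row i: these operators span a copy of gl_(r+1). *)
Definition pol i j p : P := \sum_c rX i c * rd j c p.

Lemma pol_is_linear i j : linear (pol i j).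
Proof.
move=> a p q; rewrite /pol scaler_sumr -big_split; apply: eq_bigr => c _ /=.
by rewrite linearP mulrDr scalerAr.
Qed.
HB.instance Definition _ i j :=
  GRing.isLinear.Build C P P _ (pol i j) (pol_is_linear i j).

Lemma polM i j p q : pol i j (p * q) = pol i j p * q + p * pol i j q.
Proof.
rewrite /pol mulr_suml mulr_sumr -big_split; apply: eq_bigr => c _ /=.
by rewrite rdM; ring.
Qed.

Lemma pol1 i j : pol i j 1 = 0.
Proof. by rewrite /pol big1 // => c _; rewrite rd1 mulr0. Qed.

Lemma dot_pol i j p q : dot (pol i j p) q = dot p (pol j i q).
Proof.
rewrite /pol dot_suml dot_sumr; apply: eq_bigr => c _.
by rewrite dot_rX dot_rXr.
Qed.

Lemma rd_pol i c j k p :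
  rd i c (pol j k p) = (if i == j then rd k c p else 0) + pol j k (rd i c p).
Proof.
rewrite /pol linear_sum /=.
under eq_bigr => e _ do rewrite rdM rd_rX rdC.
rewrite big_split; congr (_ + _) => /=; case: eqP => _ /=.
  rewrite (bigD1 c) //= eqxx mul1r big1 ?addr0 // => e ec.
  by rewrite eq_sym (negPf ec) mul0r.
by rewrite big1 // => e _; rewrite mul0r.
Qed.

Lemma pol_comm i j k l p :
  pol i j (pol k l p) = pol k l (pol i j p)
    + (if j == k then pol i l p else 0) - (if l == i then pol k j p else 0).
Proof.
have expand i' j' k' l' : pol i' j' (pol k' l' p) =
    (if j' == k' then pol i' l' p else 0)
    + \sum_c \sum_e rX i' c * rX k' e * rd l' e (rd j' c p).
  rewrite {1}/pol; under eq_bigr => c _ do rewrite rd_pol mulrDr.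
  rewrite big_split; congr (_ + _) => /=.
    by case: eqP => // _; rewrite big1 // => c _; rewrite mulr0.
  apply: eq_bigr => c _; rewrite /pol mulr_sumr; apply: eq_bigr => e _.
  by rewrite mulrA.
rewrite !expand [in RHS]exchange_big /=.
rewrite [X in _ = _ + X + _ - _](_ : _ =
    \sum_c \sum_e rX i c * rX k e * rd l e (rd j c p)); first by ring.
apply: eq_bigr => c _; apply: eq_bigr => e _.
by rewrite [rX k e * _]mulrC rdC.
Qed.

(** The contraction D_k of row 0 with row k. *)
Definition lap k p : P := \sum_c rd ord0 c (rd k c p).

Lemma lap_is_linear k : linear (lap k).
Proof.
move=> a p q; rewrite /lap scaler_sumr -big_split; apply: eq_bigr => c _ /=.
by rewrite !linearP.
Qed.
HB.instance Definition _ k :=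
  GRing.isLinear.Build C P P _ (lap k) (lap_is_linear k).

Lemma lapC k l p : lap k (lap l p) = lap l (lap k p).
Proof.
have expand k' l' : lap k' (lap l' p) =
    \sum_c \sum_e rd ord0 c (rd k' c (rd ord0 e (rd l' e p))).
  rewrite /lap; apply: eq_bigr => c _.
  by rewrite (linear_sum (rd k' c)) (linear_sum (rd ord0 c)).
rewrite !expand exchange_big; apply: eq_bigr => c _; apply: eq_bigr => e _ /=.
by rewrite (rdC k) (rdC k) (rdC ord0 e) (rdC ord0 e).
Qed.

Lemma pol_lap i j k p : i != ord0 -> j != ord0 ->
  pol i j (lap k p) = lap k (pol i j p) - (if i == k then lap j p else 0).
Proof.
move=> i0 j0; rewrite /lap !linear_sum /=.
have -> : (if i == k then \sum_c rd ord0 c (rd j c p) else 0) =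
    \sum_c (if i == k then rd ord0 c (rd j c p) else 0).
  by case: eqP => // _; rewrite big1.
rewrite -sumrB; apply: eq_bigr => c _.
rewrite (rd_pol k) linearD /= (rd_pol ord0) [ord0 == _]eq_sym (negPf i0) add0r eq_sym.
by case: eqP => _; rewrite ?linear0 /=; ring.
Qed.

Lemma pol00_lap k p : k != ord0 ->
  pol ord0 ord0 (lap k p) = lap k (pol ord0 ord0 p) - lap k p.
Proof.
move=> k0; rewrite /lap (linear_sum (pol _ _)) -sumrB; apply: eq_bigr => c _ /=.
by rewrite (rd_pol k) (negPf k0) add0r (rd_pol ord0) eqxx; ring.
Qed.

(** [pol i i] is a sum of products of an operator with its adjoint, hence nonnegative. This takes
    the place of degree counts: too many contractions or raisings out of a row make the eigenvalue
    negative. *)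
Lemma pol_eigen_lt0 i p (c : C) : pol i i p = c *: p -> c < 0 -> p = 0.
Proof.
move=> ep c0; apply: dot_eq0; apply/eqP; rewrite eq_le dot_ge0 andbT.
rewrite -(nmulr_rge0 _ c0) -dotZl -ep /pol dot_suml.
by apply: sumr_ge0 => e _; rewrite dot_rX dot_ge0.
Qed.

End RowVariables.

Fixpoint words (T : Type) (s : seq T) (k : nat) : seq (seq T) :=
  if k is k'.+1 then [seq i :: w | i <- s, w <- words s k'] else [:: [::]].

Lemma big_words (V : nmodType) (T : Type) (s : seq T) k (f : seq T -> V) :
  \sum_(I <- words s k.+1) f I = \sum_(i <- s) \sum_(I <- words s k) f (i :: I).
Proof. by rewrite /= big_allpairs_dep. Qed.

Lemma mem_words (T : eqType) (s : seq T) k I :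
  (I \in words s k) = (size I == k) && all (mem s) I.
Proof.
elim: k I => [|k IH] [|i I]; rewrite ?inE //.
  by apply/allpairsPdep => -[? [? []]].
rewrite /= eqSS; apply/allpairsPdep/and3P => [[i' [I' [i's + [-> ->]]]]|[sI iS aI]].
  by rewrite IH => /andP[-> ->].
by exists i, I; rewrite IH sI.
Qed.

Lemma big_pick (V : nmodType) (T : eqType) (s : seq T) (f : T -> V) i :
  uniq s -> i \in s -> \sum_(j <- s) (if j == i then f j else 0) = f i.
Proof.
move=> us iS; rewrite (bigD1_seq i) //= eqxx big1 ?addr0 //.
by move=> j /negPf ->.
Qed.

(** * Norms of words of raising operators *)

Section Invariant.
Variables (C : numClosedFieldType) (r N : nat).
Local Notation P := {mpoly C[#|{: 'I_r.+1 * 'I_N}|]}.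
Implicit Types (p q u v : P) (i j k l : 'I_r.+1) (I J : seq 'I_r.+1).

Variables (s : 'I_r.+1) (O : seq 'I_r.+1).
Hypothesis O_uniq : uniq O.
Hypothesis sO : s \notin O.

Let sOF i : i \in O -> (s == i) = false.
Proof. by move=> iO; apply: contraNF sO => /eqP ->. Qed.
Let sOF' i : i \in O -> (i == s) = false.
Proof. by rewrite eq_sym; apply: sOF. Qed.

Definition pols I v := foldr (fun i => pol s i) v I.

Lemma pol_s_comm i j v : i \in O -> j \in O ->
  pol s i (pol s j v) = pol s j (pol s i v).
Proof. by move=> iO jO; rewrite pol_comm !sOF' ?addr0 ?subr0. Qed.

Lemma pols_rem i I v : i \in O -> all (mem O) I -> i \in I ->
  pols I v = pol s i (pols (rem i I) v).
Proof.
move=> iO; elim: I => //= j I IH /andP[jO aI].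
rewrite inE [i == j]eq_sym; case: eqP => [-> //|_] /= iI.
by rewrite IH //= pol_s_comm.
Qed.

(** Under the gl of the rows in O, z spans a one-dimensional representation, c times the trace. *)
Variables (c : nat) (m1 : C) (z : P).
Hypothesis z_diag : forall i, i \in O -> pol i i z = c%:R *: z.
Hypothesis z_off : forall i j, i \in O -> j \in O -> i != j -> pol i j z = 0.
Hypothesis z_s : pol s s z = m1 *: z.

Lemma pol_ss_pols I : all (mem O) I ->
  pol s s (pols I z) = (m1 + (size I)%:R) *: pols I z.
Proof.
elim: I => [|i I IH] /=; first by rewrite addr0.
case/andP=> iO aI; rewrite pol_comm eqxx sOF' // subr0 IH // linearZ /=.
by rewrite -[X in _ + X]scale1r -scalerDl -addrA -natr1.
Qed.

Lemma pol_diag_pols j I : j \in O -> all (mem O) I ->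
  pol j j (pols I z) = (c%:R - (count_mem j I)%:R) *: pols I z.
Proof.
move=> jO; elim: I => [|i I IH] /=; first by rewrite subr0 z_diag.
case/andP=> iO aI; rewrite pol_comm sOF' // addr0 IH // linearZ /=.
case: eqP => [->|_]; last by rewrite subr0.
by rewrite -[X in _ - X]scale1r -scalerBl natrD opprD addrCA [X in X *: _]addrC.
Qed.

Lemma pol_pol_pols i j I : i \in O -> j \in O -> all (mem O) I ->
  pol s j (pol j i (pols I z)) =
    ((if i == j then c%:R else 0) - (count_mem j I)%:R) *: pol s i (pols I z).
Proof.
move=> iO jO; elim: I => [|l I IH] /=.
  rewrite subr0; case: eqP => [->|/eqP ij]; first by rewrite z_diag // linearZ.
  by rewrite z_off // 1?eq_sym // linear0 scale0r.
case/andP=> lO aI; rewrite (pol_comm j i) sOF' // addr0 linearB /=.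
rewrite (pol_s_comm _ jO lO) IH // linearZ /= (pol_s_comm _ lO iO).
case: (eqVneq l j) => [->|lj] /=; last by rewrite linear0 subr0.
rewrite (pol_s_comm _ jO iO) -[X in _ - X]scale1r -scalerBl natrD.
by congr (_ *: _); ring.
Qed.

(** For a word in the single letter j, [pol j j] has a negative eigenvalue. Any other word comes
    from one with one more j, because [pol j i] turns letters j into i up to a nonzero factor. *)
Lemma pols_eq0 I : all (mem O) I -> (c < size I)%N -> pols I z = 0.
Proof.
move=> aI sI.
have [j jO] : exists j, j \in O.
  by case: (I) aI sI => // j I' /andP[jO _] _; exists j.
have [d] := ubnPleq (count (predC1 j) I).
elim: d I aI sI => [|d IH] I aI sI.
  rewrite leqn0 => /eqP d0; apply: (pol_eigen_lt0 (i := j) (pol_diag_pols jO aI)).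
  rewrite subr_lt0 ltr_nat (leq_trans sI) //.
  by rewrite -(count_predC (pred1 j) I) [X in (_ + X)%N]d0 addn0.
rewrite leq_eqVlt ltnS => /orP[|]; last exact: IH.
move=> cnt; have : has (predC1 j) I by rewrite has_count (eqP cnt).
case/hasP => i iI /= ij; have iO : i \in O by apply: (allP aI).
rewrite (pols_rem _ iO aI iI); set J := rem i I.
have pIJ := perm_to_rem iI; rewrite -/J in pIJ.
have aJ : all (mem O) J by move: aI; rewrite (perm_all _ pIJ) => /andP[].
have : pols (j :: J) z = 0.
  apply: IH => /=; first by rewrite jO.
    by move: sI; rewrite (perm_size pIJ).
  by move: cnt; rewrite (seq.permP pIJ) /= ij eqxx eqSS add0n => /eqP->.
move/(congr1 (pol j i)); rewrite linear0 /= pol_comm sOF' // eqxx addr0.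
rewrite pol_pol_pols // (negPf ij) sub0r -scaleN1r -scalerDl => /eqP.
by rewrite scaler_eq0 -opprD oppr_eq0 natr1 pnatr_eq0 /= => /eqP.
Qed.

Definition Omega v := \sum_(i <- O) pol i s (pol s i v).

Let w (p : nat) : C := p%:R * (m1 + (size O)%:R - c%:R + p%:R).

(** Thus [Omega] + w p, taken on words of length p, commutes with the raising operators. The
    increment of w is m1 + p + 1 from [pol s s], plus p + |O| - c from moving the operators
    [pol j i] through the word. *)
Lemma Omega_pols i I : i \in O -> all (mem O) I ->
  pol s i (Omega (pols I z)) =
  Omega (pols (i :: I) z) + (w (size I).+1 - w (size I)) *: pols (i :: I) z.
Proof.
move=> iO aI; rewrite /Omega linear_sum /=.
set v := pol s i _.
have eq1 j : j \in O -> pol s i (pol j s (pol s j (pols I z))) =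
    pol j s (pol s j v) + (if j == i then pol s s v else 0) - pol j i (pol s j (pols I z)).
  move=> jO; rewrite pol_comm eqxx -(pol_s_comm _ iO jO) -/v.
  rewrite [i == j]eq_sym; case: eqP => [->|_]; last by [].
  by rewrite -/v.
rewrite (eq_big_seq _ eq1) sumrB big_split /= -addrA; congr (_ + _).
have -> : \sum_(j <- O) (if j == i then pol s s v else 0) =
    (m1 + (size I).+1%:R) *: v.
  rewrite big_pick // -[v]/(pols (i :: I) z) pol_ss_pols //=.
  by rewrite iO.
have eq2 j : j \in O -> pol j i (pol s j (pols I z)) =
    ((if i == j then c%:R else 0) - (count_mem j I)%:R) *: v - v.
  by move=> jO; rewrite pol_comm eqxx sOF' // addr0 pol_pol_pols.
rewrite (eq_big_seq _ eq2) sumrB -scaler_suml sumrB.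
under eq_bigr => j _ do rewrite eq_sym.
rewrite big_pick // -natr_sum (_ : \sum_(j <- O) _ = size I)%N; last first.
  elim: (I) aI => [|l J IH] /=; first by rewrite big1.
  case/andP=> lO /IH e; rewrite big_split /= e (bigD1_seq l) //= eqxx.
  by rewrite big1 // => j /negPf; rewrite eq_sym => ->.
rewrite big_const_seq count_predT iter_addr_0 -scaler_nat -scalerBl -[RHS]/(_ *: v) -scalerBl.
by congr (_ *: _); rewrite /w /= -natr1; ring.
Qed.

Definition level (n : nat) := \sum_(I <- words O n) dot (pols I z) (pols I z).

Lemma level_ge0 n : 0 <= level n.
Proof. by apply: sumr_ge0 => I _; apply: dot_ge0. Qed.

Lemma level_eq0 n : (c < n)%N -> level n = 0.
Proof.
move=> cn; rewrite /level big1_seq // => I; rewrite mem_words => /and3P[_ /eqP sI aI].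
by rewrite (pols_eq0 aI) ?sI // dot0l.
Qed.

Lemma dot_Omega u v : dot u (Omega v) = \sum_(i <- O) dot (pol s i u) (pol s i v).
Proof. by rewrite /Omega dot_sumr; apply: eq_bigr => i _; rewrite dot_pol. Qed.

Lemma dot_Omegal u v : dot (Omega u) v = \sum_(i <- O) dot (pol s i u) (pol s i v).
Proof. by rewrite /Omega dot_suml; apply: eq_bigr => i _; rewrite dot_pol. Qed.

Lemma levelS n :
  level n.+1 = \sum_(I <- words O n) dot (Omega (pols I z)) (pols I z).
Proof.
rewrite /level big_words exchange_big; apply: eq_bigr => I _.
by rewrite dot_Omegal.
Qed.

Lemma level_Omega n :
  \sum_(I <- words O n) dot (Omega (pols I z)) (Omega (pols I z)) =
  level n.+2 + (w n.+1 - w n) * level n.+1.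
Proof.
rewrite levelS [X in _ = X + _]big_words /level big_words mulr_sumr -big_split.
rewrite (eq_bigr _ (fun I _ => dot_Omega (Omega (pols I z)) (pols I z))).
rewrite exchange_big /=; apply: eq_big_seq => i iO.
rewrite mulr_sumr -big_split; apply: eq_big_seq => I /=.
rewrite mem_words => /andP[/eqP sI aI].
by rewrite Omega_pols // sI dotDl dotZl.
Qed.

(* Expanding ||(Omega - (w L - w n)) v||^2 >= 0 over the words of length n bounds
   level n.+1 once level n.+2 is bounded, so the induction runs downwards from L. *)
Lemma level_step L : (forall n, (n < L)%N -> 0 < w L - w n) -> level L.+1 = 0 ->
  forall n, (n <= L)%N -> level n.+1 <= (w L - w n) * level n.
Proof.
move=> wL lev0 n nL; rewrite -(subKn nL); elim: (L - n)%N (leq_subr n L) => [|d IH] dL.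
  by rewrite subn0 lev0 subrr mul0r.
set k := (L - d.+1)%N; have kS : (L - d = k.+1)%N by rewrite /k subnSK.
have kL : (k < L)%N by rewrite /k ltn_subrL (leq_trans _ dL).
set t := w L - w k; have t0 : 0 < t by apply: wL.
have := IH (ltnW dL); rewrite kS => lev2.
have : 0 <= \sum_(I <- words O k)
    dot (Omega (pols I z) - t *: pols I z) (Omega (pols I z) - t *: pols I z).
  by apply: sumr_ge0 => I _; apply: dot_ge0.
have tt : t^* = t by apply/CrealP; rewrite realE ltW.
have -> : \sum_(I <- words O k)
    dot (Omega (pols I z) - t *: pols I z) (Omega (pols I z) - t *: pols I z)
   = level k.+2 + (w k.+1 - w k) * level k.+1 - 2%:R * t * level k.+1 + t ^+ 2 * level k.
  rewrite -level_Omega levelS /level !mulr_sumr -sumrN -!big_split /=.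
  apply: eq_bigr => I _; rewrite !(dotDl, dotDr, dotNl, dotNr, dotZl, dotZr) tt.
  by rewrite (dot_Omega (pols I z)) -dot_Omegal; ring.
move=> ge0; rewrite -(ler_pM2l t0) -subr_ge0.
apply: le_trans ge0 _; rewrite -subr_ge0.
have -> : t * (t * level k) - t * level k.+1 - (level k.+2 + (w k.+1 - w k) * level k.+1
    - 2 * t * level k.+1 + t ^+ 2 * level k) =
    (w L - w k.+1) * level k.+1 - level k.+2.
  by rewrite /t; ring.
by rewrite subr_ge0.
Qed.

End Invariant.

(** * Contractions against a merged row *)

Lemma leq_bin (n k : nat) : (0 < k < n)%N -> (n <= 'C(n, k))%N.
Proof.
elim: n k => [|n IH] [|k] //; rewrite ltnS => /=; rewrite leq_eqVlt => /orP[/eqP<-|kn].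
  by rewrite binSn.
by rewrite binS -[n.+1]addn1 leq_add ?IH ?bin_gt0 // -ltnS ltnW // ltnW.
Qed.

(** The right side equals a(a-1)(a-2) binomial(a-3, m-3), and this binomial is at least a-3. With a
    >= b+1 it remains to see that b+2 <= (b-1)(b-2), that is, b >= 4. *)
Lemma bin_ge_cubic (a b m : nat) : (3 < b < a)%N -> (3 < m <= b)%N ->
  ((b + 2) * (b + 1) * b <= m ^_ 3 * 'C(a, m))%N.
Proof.
case: a => [|[|[|a]]] /andP[b3 ba] /andP[m3 mb]; try by lia.
case: m m3 mb => [|[|[|m]]] // m3 mb.
have -> : (m.+3 ^_ 3 * 'C(a.+3, m.+3) = a.+3 ^_ 3 * 'C(a, m))%N.
  rewrite !ffactnS !ffactn0 /= !muln1.
  have e1 := mul_bin_diag a.+3 m.+2; have e2 := mul_bin_diag a.+2 m.+1.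
  have e3 := mul_bin_diag a.+1 m; rewrite /= in e1 e2 e3.
  transitivity (m.+2 * m.+1 * (m.+3 * 'C(a.+3, m.+3)))%N; first by ring.
  rewrite -e1; transitivity (a.+3 * m.+1 * (m.+2 * 'C(a.+2, m.+2)))%N; first by ring.
  rewrite -e2; transitivity (a.+3 * a.+2 * (m.+1 * 'C(a.+1, m.+1)))%N; first by ring.
  by rewrite -e3; ring.
have C1 : (a <= 'C(a, m))%N by apply: leq_bin; lia.
apply: leq_trans (leq_mul (leqnn _) C1).
have [d ->] : exists d, a = (b - 4 + d + 2)%N by exists (a + 2 - b)%N; lia.
have [e ->] : exists e, b = e.+4 by exists (b - 4)%N; lia.
rewrite !ffactnS !ffactn0 /= !muln1.
have -> : (e.+4 - 4 + d + 2 = (e + d).+2)%N by lia.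
apply: (@leq_trans (e.+2.+3 * (e.+2.+2 * e.+2.+1) * e.+2)); last first.
  by rewrite !leq_mul //; lia.
nia.
Qed.

Section Contraction.
Variables (C : numClosedFieldType) (r N : nat).
Local Notation P := {mpoly C[#|{: 'I_r.+1 * 'I_N}|]}.
Implicit Types (p q u v : P) (i j k l : 'I_r.+1) (I J : seq 'I_r.+1).

Definition laps I v := foldr (fun i => lap i) v I.

Lemma laps_is_linear I : linear (laps I).
Proof. by elim: I => // i I IH a u v /=; rewrite IH linearP. Qed.
HB.instance Definition _ I :=
  GRing.isLinear.Build C P P _ (laps I) (laps_is_linear I).

Lemma laps_lap I i v : laps I (lap i v) = lap i (laps I v).
Proof. by elim: I => //= j I ->; rewrite lapC. Qed.

Lemma iter_lap_lap n i j v : iter n (lap i) (lap j v) = lap j (iter n (lap i) v).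
Proof. by elim: n => //= n ->; rewrite lapC. Qed.

Definition contract (s : seq 'I_r.+1) n v :=
  \sum_(I <- words s n) dot (laps I v) (laps I v).

Lemma contract0 s v : contract s 0 v = dot v v.
Proof. by rewrite /contract big_seq1. Qed.

Lemma contractS s n v : contract s n.+1 v = \sum_(i <- s) contract s n (lap i v).
Proof.
rewrite /contract big_words; apply: eq_bigr => i _; apply: eq_bigr => I _ /=.
by rewrite laps_lap.
Qed.

(** Contractions commute, so words may be sorted by the number m of letters taken from s, whose
    positions give the binomial. *)
Lemma contract_cons s0 s n v : contract (s0 :: s) n v =
  \sum_(m < n.+1) 'C(n, m)%:R * contract s m (iter (n - m) (lap s0) v).
Proof.
elim: n v => [|n IH] v.
  by rewrite big_ord1 mul1r !contract0.
rewrite contractS big_cons IH (eq_bigr _ (fun i _ => IH (lap i v))).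
rewrite exchange_big /= [RHS]big_ord_recl /= ?bin0 ?mul1r ?subn0.
under [X in _ + X]eq_bigr => m _ do
  rewrite -mulr_sumr (eq_bigr _ (fun i _ => congr1 (contract s m)
            (iter_lap_lap (n - m) s0 i v))) -contractS.
rewrite big_ord_recl /= ?bin0 ?mul1r ?subn0 -iterSr -addrA; congr (_ + _).
pose f m := 'C(n, m.+1)%:R * contract s m.+1 (iter (n - m) (lap s0) v).
rewrite [X in X + _](_ : _ = \sum_(m < n.+1) f m); last first.
  rewrite big_ord_recr /= {2}/f bin_small // mul0r addr0.
  by apply: eq_bigr => m _; rewrite /bump /= add1n -iterSr subnSK.
rewrite -big_split; apply: eq_bigr => m _ /=.
by rewrite /bump /= add1n subSS binS natrD mulrDl.
Qed.

Variables (s : 'I_r.+1) (O : seq 'I_r.+1).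
Hypotheses (O_uniq : uniq O) (sO : s \notin O) (s0 : s != ord0) (O0 : ord0 \notin O).
Variables (a b c : nat) (F : P).
Hypothesis F_diag : forall i, i \in O -> pol i i F = c%:R *: F.
Hypothesis F_off : forall i j, i \in O -> j \in O -> i != j -> pol i j F = 0.
Hypothesis F_up : forall i, i \in O -> pol s i F = 0.
Hypothesis F_s : pol s s F = b%:R *: F.
Hypothesis F_0 : pol ord0 ord0 F = a%:R *: F.

Let z n := iter n (lap s) F.

Let O0' i : i \in O -> i != ord0.
Proof. by move=> iO; apply: contraNneq O0 => <-. Qed.
Let sO' i : i \in O -> (i == s) = false.
Proof. by move=> iO; apply: contraNF sO => /eqP <-. Qed.

Lemma z_diag n i : i \in O -> pol i i (z n) = c%:R *: z n.
Proof.
move=> iO; elim: n => [|n IH]; first exact: F_diag.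
by rewrite /= pol_lap ?O0' // sO' // subr0 IH linearZ.
Qed.

Lemma z_off n i j : i \in O -> j \in O -> i != j -> pol i j (z n) = 0.
Proof.
move=> iO jO ij; elim: n => [|n IH]; first exact: F_off.
by rewrite /= pol_lap ?O0' // sO' // subr0 IH linear0.
Qed.

Lemma z_s n : pol s s (z n) = (b%:R - n%:R) *: z n.
Proof.
elim: n => [|n IH]; first by rewrite subr0 F_s.
rewrite /= pol_lap // eqxx IH linearZ /= -[X in _ - X]scale1r -scalerBl.
by rewrite -addrA -opprD natr1.
Qed.

Lemma z_up n i : i \in O -> pol s i (z n) = - n%:R *: lap i (z n.-1).
Proof.
move=> iO; elim: n => [|n IH]; first by rewrite /= F_up // oppr0 scale0r.
rewrite /= pol_lap ?s0 ?O0' // eqxx IH linearZ /= lapC.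
case: n {IH} => [|n] /=; first by rewrite oppr0 scale0r sub0r scaleN1r.
by rewrite -[X in _ - X]scale1r -scalerBl -opprD natr1.
Qed.

(** A raising operator passing through the factors D_s replaces each in turn by -D_i and finally
    kills F. The number of factors left to replace drops by one each time, whence the falling
    factorial. *)
Lemma pols_z n I : all (mem O) I ->
  pols s I (z n) =
  ((-1) ^+ size I * (n ^_ size I)%:R) *: laps I (z (n - size I)).
Proof.
elim: I => [|i I IH] /=; first by rewrite mul1r ffactn0 subn0 scale1r.
case/andP=> iO aI; rewrite IH // linearZ /=.
have -> v : pol s i (laps I v) = laps I (pol s i v).
  elim: (I) aI => //= j J IHJ /andP[jO aJ].
  by rewrite pol_lap ?s0 ?O0' // eq_sym sO' // subr0 IHJ.
rewrite z_up // linearZ /= scalerA laps_lap subnS ffactnSr natrM exprS.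
by congr (_ *: _); ring.
Qed.

Lemma level_contract n m :
  level s O (z n) m = (n ^_ m)%:R ^+ 2 * contract O m (z (n - m)).
Proof.
rewrite /level /contract mulr_sumr; apply: eq_big_seq => I.
rewrite mem_words => /andP[/eqP sI aI]; rewrite pols_z // sI dotZl dotZr.
rewrite rmorphM rmorphXn rmorphN1 /= conjC_nat mulrA; congr (_ * _).
by rewrite mulrACA -exprMn mulrNN mulr1 expr1n mul1r expr2.
Qed.

Lemma contract_gt_a n : (a < n)%N -> contract (s :: O) n F = 0.
Proof.
move=> an; rewrite /contract big1_seq // => I /andP[_].
rewrite mem_words => /andP[/eqP sI aI].
suff -> : laps I F = 0 by rewrite dot0l.
apply: (pol_eigen_lt0 (i := ord0) (c := a%:R - n%:R)); last by rewrite subr_lt0 ltr_nat.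
rewrite -{}sI; elim: I aI => [|i I IH] /=; first by rewrite subr0.
case/andP=> iO aI; rewrite pol00_lap; last first.
  by move: iO; rewrite inE => /predU1P[->|/O0'].
rewrite IH // linearZ /= -[X in _ - X]scale1r -scalerBl.
by rewrite -addrA -opprD natr1.
Qed.

Lemma z_gt_b n : (b < n)%N -> z n = 0.
Proof.
move=> bn; apply: (pol_eigen_lt0 (z_s n)).
by rewrite subr_lt0 ltr_nat.
Qed.

Lemma contract_gt_c n m : (c < m <= n)%N -> contract O m (z (n - m)) = 0.
Proof.
case/andP=> cm mn; have := level_contract n m.
rewrite (@level_eq0 _ _ _ s O sO c _ (@z_diag n) (@z_off n)) // => /esym/eqP.
by rewrite mulf_eq0 expf_eq0 /= pnatr_eq0 eqn0Ngt ffact_gt0 mn => /eqP.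
Qed.

Let w n (p : nat) : C := p%:R * (b%:R - n%:R + (size O)%:R - c%:R + p%:R).

Lemma contract_step L n : (forall p : nat, (p < L)%N -> 0 < w n L - w n p) ->
    level s O (z n) L.+1 = 0 -> forall p : nat, (p <= L)%N ->
  level s O (z n) p.+1 <= (w n L - w n p) * level s O (z n) p.
Proof.
move=> wL l0 p pL.
by have := level_step O_uniq sO (@z_diag n) (@z_off n) (z_s n) wL l0; apply.
Qed.

(** The levels of [z 2] stop at 2, only two contractions being available for conversion. If both
    level bounds were equalities, the left side would be binomial(b + |O| - 1, 2) times the norm of
    [z 2]; hence the bound on b + |O|. *)
Lemma contract2_le : c = 3 -> (1 < b)%N -> (0 < size O)%N ->
  (3 < b + size O)%N -> (b + size O <= a.+1)%N ->
  contract (s :: O) 2 F <= 'C(a, 2)%:R * dot (z 2) (z 2).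
Proof.
move=> c3 b1 o0 bo boa; pose B : C := b%:R + (size O)%:R - 2.
have B1 : 2 <= B by rewrite /B lerBrDr -!natrD ler_nat.
have lev (p : nat) := level_contract 2 p.
have w2 : w 2 2 - w 2 0 = 2 * (B - 1) by rewrite /w /B c3; ring.
have w1 : w 2 2 - w 2 1 = B by rewrite /w /B c3; ring.
have l3 : level s O (z 2) 3 = 0 by rewrite lev ffact_small // mulr0n expr0n mul0r.
have step := contract_step _ l3.
have [s1 s2] : level s O (z 2) 1 <= 2 * (B - 1) * level s O (z 2) 0 /\
    level s O (z 2) 2 <= B * level s O (z 2) 1.
  have wpos (p : nat) : (p < 2)%N -> 0 < w 2 2 - w 2 p.
    case: p => [|[|//]] _; rewrite ?w1 ?w2.
      by rewrite mulr_gt0 // subr_gt0 (lt_le_trans _ B1) // ltr1n.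
    by rewrite (lt_le_trans _ B1) // ltr0n.
  by split; [rewrite -w2|rewrite -w1]; apply: step.
pose k m := contract O m (z (2 - m)).
have [e0 [e1 e2]] : level s O (z 2) 0 = k 0%N /\ (level s O (z 2) 1 = 4 * k 1%N /\
    level s O (z 2) 2 = 4 * k 2%N).
  by rewrite !lev /k !ffactE /=; split; [ring|split; ring].
rewrite -/(z 2) contract_cons !big_ord_recl big_ord0 /= /bump /=.
rewrite -[dot _ _](contract0 O) -[contract O 0 _]/(k 0%N) -[contract O 1 _]/(k 1%N).
rewrite -[contract O 2 _]/(k 2%N) addr0 bin0 bin1 binn.
rewrite e0 e1 e2 in s1 s2.
have k0 : 0 <= k 0%N by rewrite -e0 level_ge0.
have B0 : 0 <= B by apply: le_trans B1.
rewrite -(ler_pM2l (ltr0n C 4)) -subr_ge0.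
have -> : 4 * ('C(a, 2)%:R * k 0%N) - 4 * (1 * k 0%N + (2 * k 1%N + 1 * k 2%N)) =
   2 * (a%:R * (a%:R - 1) - B * (B + 1)) * k 0%N
   + (B + 2) * (2 * (B - 1) * k 0%N - 4 * k 1%N)
   + (B * (4 * k 1%N) - 4 * k 2%N).
  have -> : a%:R * (a%:R - 1) = 2 * 'C(a, 2)%:R :> C.
    have e : ('C(a, 2) * 2 = a * a.-1)%N.
      by have := bin_ffact a 2; rewrite !ffactnS ffactn0 muln1.
    rewrite -natrM mulnC e natrM.
    by case: (a) => [|a']; rewrite ?mul0r // -natr1 addrK.
  by ring.
have aB : 0 <= a%:R - (B + 1).
  have : (b + size O)%:R <= a.+1%:R :> C by rewrite ler_nat.
  rewrite -subr_ge0 natrD -natr1 => h; rewrite (le_trans h) // le_eqVlt.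
  by rewrite (_ : _ - _ = a%:R - (B + 1)) ?eqxx // /B; ring.
have aB2 : 0 <= a%:R * (a%:R - 1) - B * (B + 1).
  have -> : a%:R * (a%:R - 1) - B * (B + 1) = (a%:R - (B + 1)) * (a%:R + B) by ring.
by apply: mulr_ge0 => //; apply: addr_ge0 => //; apply: ler0n.
apply: addr_ge0; last by rewrite subr_ge0.
apply: addr_ge0; first by apply: mulr_ge0 => //; apply: mulr_ge0.
by apply: mulr_ge0; [apply: addr_ge0 | rewrite subr_ge0].
Qed.

(** The levels stop at c = 3. If the three level bounds were equalities, n(n-1)(n-2) times the left
    side would be (b+2)(b+1)b times the norm of [z n], the quantity bounded in [bin_ge_cubic]. *)
Lemma contract_ge4_le n : c = 3 -> size O = 2 -> (3 < b)%N -> (b < a)%N ->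
  (3 < n <= b)%N -> contract (s :: O) n F <= 'C(a, n)%:R * dot (z n) (z n).
Proof.
move=> c3 o2 b3 ba /andP[n3 nb].
pose M : C := b%:R - n%:R; have M0 : 0 <= M by rewrite subr_ge0 ler_nat.
have w0 : w n 3 - w n 0 = 3 * (M + 2) by rewrite /w -/M c3 o2; ring.
have w1 : w n 3 - w n 1 = 2 * (M + 3) by rewrite /w -/M c3 o2; ring.
have w2 : w n 3 - w n 2 = M + 4 by rewrite /w -/M c3 o2; ring.
have l4 : level s O (z n) 4 = 0.
  by apply: (@level_eq0 _ _ _ s O sO c _ (@z_diag n) (@z_off n)); rewrite c3.
have wpos (p : nat) : (p < 3)%N -> 0 < w n 3 - w n p.
  by case: p => [|[|[|//]]] _; rewrite ?w0 ?w1 ?w2 ?mulr_gt0 // ltr_wpDl ?ltr0n.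
have step := contract_step wpos l4.
have := step 0%N isT; have := step 1%N isT; have := step 2%N isT.
rewrite w0 w1 w2; set S := level s O (z n) => s3 s2 s1.
have S0 : 0 <= S 0%N by apply: level_ge0.
pose k (m : nat) := contract O m (z (n - m)).
have SE (m : nat) : S m = (n ^_ m)%:R ^+ 2 * k m by rewrite /S level_contract.
have cgt := @contract_gt_c n.
have tot : contract (s :: O) n F =
    k 0%N + n%:R * k 1%N + 'C(n, 2)%:R * k 2%N + 'C(n, 3)%:R * k 3%N.
  rewrite contract_cons /k; clear -n3 cgt c3; case: n n3 cgt => [|[|[|[|q]]]] // _ cgt.
  rewrite 4!big_ord_recl big1 => [|m _]; last first.
    rewrite -[contract _ _ _]/(contract O m.+4 (z (q.+4 - m.+4))).
    by rewrite cgt ?mulr0 // c3 /= !ltnS -ltnS ltn_ord.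
  by rewrite addr0 bin0 mul1r bin1 !addrA.
pose nn : C := n%:R.
have n2E : (n ^_ 2)%:R = nn * (nn - 1).
  by rewrite ffactnSr ffactn1 natrM natrB // ltnW // ltnW // ltnW.
have n3E : (n ^_ 3)%:R = nn * (nn - 1) * (nn - 2).
  by rewrite ffactnSr natrM n2E natrB // ltnW // ltnW.
have [b2 b3'] : 'C(n, 2)%:R * 2 = nn * (nn - 1) /\ 'C(n, 3)%:R * 6 = nn * (nn - 1) * (nn - 2).
  by rewrite -n3E -n2E -!bin_ffact !natrM.
have nat_le : (b%:R + 2) * (b%:R + 1) * b%:R <= nn * (nn - 1) * (nn - 2) * 'C(a, n)%:R.
  by rewrite -n3E natr1 -!natrD -!natrM ler_nat -[b.+1]addn1 bin_ge_cubic ?b3 ?n3.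
have nn2 : 0 <= nn - 2 by rewrite subr_ge0 ler_nat ltnW // ltnW.
have nn1 : 0 <= nn - 1 by rewrite subr_ge0 ler1n ltnW // ltnW // ltnW.
have f3 : 0 < nn * (nn - 1) * (nn - 2) by rewrite -n3E ltr0n ffact_gt0 ltnW.
have dz : dot (z n) (z n) = k 0%N by rewrite /k subn0 contract0.
rewrite tot dz.
have k0 : S 0%N = k 0%N by rewrite SE ffactn0 expr1n mul1r /k subn0.
have k1 : S 1%N = nn ^+ 2 * k 1%N by rewrite SE ffactn1.
have k2 : S 2%N = (nn * (nn - 1)) ^+ 2 * k 2%N by rewrite SE n2E.
have k3 : S 3%N = (nn * (nn - 1) * (nn - 2)) ^+ 2 * k 3%N by rewrite SE n3E.
have bM : b%:R = M + nn by rewrite /M subrK.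
rewrite -(ler_pM2l f3) -(ler_pM2l (ltr0n C 6)) -subr_ge0.
(* Multipliers of the three inequalities S m.+1 <= (w n 3 - w n m) * S m, found by
   eliminating S 3, S 2 and S 1 in turn. *)
set al2 := 3 * (nn - 2) + M + 4; 
set al1 := 6 * (nn - 1) * (nn - 2) + al2 * (2 * (M + 3)).
have al2_ge0 : 0 <= al2 by do 2!apply: addr_ge0 => //; apply: mulr_ge0.
have al1_ge0 : 0 <= al1.
  apply: addr_ge0; first by do 2!apply: mulr_ge0 => //.
  by apply: mulr_ge0 => //; apply: mulr_ge0 => //; apply: addr_ge0.
have -> : 6 * (nn * (nn - 1) * (nn - 2) * ('C(a, n)%:R * k 0%N)) -
   6 * (nn * (nn - 1) * (nn - 2) * (k 0%N + n%:R * k 1%N + 'C(n, 2)%:R * k 2%N + 'C(n, 3)%:R * k 3%N)) =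
   6 * (nn * (nn - 1) * (nn - 2) * 'C(a, n)%:R - (b%:R + 2) * (b%:R + 1) * b%:R) * S 0%N
   + al1 * (3 * (M + 2) * S 0%N - S 1%N) + al2 * (2 * (M + 3) * S 1%N - S 2%N)
   + ((M + 4) * S 2%N - S 3%N).
  have -> : 6 * (nn * (nn - 1) * (nn - 2) * (k 0%N + n%:R * k 1%N + 'C(n, 2)%:R * k 2%N + 'C(n, 3)%:R * k 3%N))
   = 6 * (nn * (nn - 1) * (nn - 2)) * k 0%N + 6 * (nn * (nn - 1) * (nn - 2)) * nn * k 1%N
   + 3 * (nn * (nn - 1) * (nn - 2)) * ('C(n, 2)%:R * 2) * k 2%N
   + (nn * (nn - 1) * (nn - 2)) * ('C(n, 3)%:R * 6) * k 3%N by rewrite -/nn; ring.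
  by rewrite b2 b3' k0 k1 k2 k3 bM /al1 /al2; ring.
apply: addr_ge0; last by rewrite subr_ge0.
apply: addr_ge0; last by rewrite mulr_ge0 // subr_ge0.
apply: addr_ge0; last by rewrite mulr_ge0 // subr_ge0.
by rewrite !mulr_ge0 // subr_ge0.
Qed.

(** Each term is, up to a nonzero factor, a level of [z n], and [z n] vanishes. *)
Lemma contract_gt_b n : (b < n)%N -> contract (s :: O) n F = 0.
Proof.
move=> bn; rewrite contract_cons big1 // => m _.
have mn : (m <= n)%N by rewrite -ltnS.
have := level_contract n m; rewrite /level big1 => [|I _]; last first.
  rewrite z_gt_b // (_ : pols s I 0 = 0) ?dot0l //.
  by elim: I => //= i I ->; rewrite linear0.
move=> /esym/eqP; rewrite mulf_eq0 expf_eq0 /= pnatr_eq0 eqn0Ngt ffact_gt0 mn.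
by move/eqP => ->; rewrite mulr0.
Qed.

(** Evenness removes n = 1 and n = 3, which lie outside the range of the bounds for n = 2 and n >=
    4. *)
Lemma contract_le n : ~~ odd n ->
    [\/ O = [::], [/\ c = 3, size O = 1%N, b = 3 & (2 < a)%N] |
        [/\ c = 3, size O = 2 & (3 < b < a)%N]] ->
  contract (s :: O) n F <= 'C(a, n)%:R * dot (z n) (z n).
Proof.
move=> even_n hyp.
have rhs_ge0 : 0 <= 'C(a, n)%:R * dot (z n) (z n).
  by rewrite mulr_ge0 ?dot_ge0 ?ler0n.
have [an|na] := ltnP a n; first by rewrite contract_gt_a.
have [bn|nb] := ltnP b n; first by rewrite contract_gt_b.
case: hyp => [O_nil|[c3 o1 b3 a2]|[c3 o2 /andP[b3 ba]]].
- rewrite contract_cons big_ord_recl big1 => [|m _]; last first.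
    by rewrite O_nil /contract big_nil mulr0.
  rewrite addr0 bin0 mul1r subn0 contract0 -[X in X <= _]mul1r.
  by rewrite ler_wpM2r ?dot_ge0 // ler1n bin_gt0.
- case: n even_n nb {na rhs_ge0} => [|[|[|[|n]]]] // _; rewrite ?b3 // => _.
    by rewrite contract0 bin0 mul1r.
  by apply: contract2_le; rewrite // ?b3 ?o1.
case: n even_n nb {na rhs_ge0} => [|[|[|[|n]]]] // _ nb.
- by rewrite contract0 bin0 mul1r.
- by apply: contract2_le; rewrite // ?o2 ?addn2 ?addn1 // ltnW // ltnW.
- exact: contract_ge4_le.
Qed.

End Contraction.

(** * Products of linear forms *)

Lemma leibniz_prod (R : comNzRingType) (D : R -> R) (I : eqType)
    (s : seq I) (f : I -> R) :
    D 1 = 0 -> (forall p q, D (p * q) = D p * q + p * D q) -> uniq s ->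
  D (\prod_(x <- s) f x) = \sum_(x <- s) D (f x) * \prod_(y <- s | y != x) f y.
Proof.
move=> D1 DM; elim: s => [|x s IH] /=; first by rewrite !big_nil.
case/andP=> xs us; rewrite !big_cons DM IH // eqxx /=; congr (_ * _ + _).
  rewrite [LHS]big_seq [RHS]big_seq_cond; apply: eq_bigl => y.
  by case: (eqVneq y x) => [->|_]; rewrite ?(negPf xs) // andbT.
rewrite mulr_sumr; apply: eq_big_seq => y ys.
rewrite big_cons ifT 1?mulrCA //.
by apply: contraNneq xs => ->.
Qed.

Lemma leibniz_prod_in (R : comNzRingType) (D : R -> R) (I : finType)
    (A : pred I) (f : I -> R) :
    D 1 = 0 -> (forall p q, D (p * q) = D p * q + p * D q) ->
  D (\prod_(x in A) f x) = \sum_(x in A) D (f x) * \prod_(y in A | y != x) f y.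
Proof.
move=> D1 DM; rewrite -big_enum leibniz_prod ?enum_uniq // big_enum /=.
by apply: eq_bigr => x _; rewrite big_enum_cond.
Qed.

Section LinearForms.
Variables (C : numClosedFieldType) (r N : nat).
Local Notation P := {mpoly C[#|{: 'I_r.+1 * 'I_N}|]}.
Implicit Types (p q u v : P) (i j k l : 'I_r.+1) (a b : 'I_N -> C).

Definition lf a i : P := \sum_c a c *: rX C i c.

(** The coefficients are conjugated to make this the adjoint of multiplication by [lf a i]. *)
Definition der a i p : P := \sum_c (a c)^* *: rd i c p.

Lemma der_is_linear a i : linear (der a i).
Proof.
move=> e p q; rewrite /der scaler_sumr -big_split; apply: eq_bigr => c _ /=.
by rewrite linearP scalerDr !scalerA mulrC.
Qed.
HB.instance Definition _ a i :=
  GRing.isLinear.Build C P P _ (der a i) (der_is_linear a i).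

Lemma derM a i p q : der a i (p * q) = der a i p * q + p * der a i q.
Proof.
rewrite /der mulr_suml mulr_sumr -big_split; apply: eq_bigr => c _ /=.
by rewrite rdM scalerDr scalerAl scalerAr.
Qed.

Lemma der1 a i : der a i 1 = 0.
Proof. by rewrite /der big1 // => c _; rewrite rd1 scaler0. Qed.

Lemma rd_lf a i j c : rd i c (lf a j) = (if i == j then a c else 0) *: 1.
Proof.
rewrite /lf linear_sum (bigD1 c) //= linearZ /= rd_rX eqxx andbT big1 ?addr0.
  by case: (i == j); rewrite ?scaler0 ?scale0r.
by move=> e ec; rewrite linearZ /= rd_rX (eq_sym c) (negPf ec) andbF scaler0.
Qed.

Lemma der_lf a b i j : der a i (lf b j) =
  (if i == j then \sum_c b c * (a c)^* else 0) *: 1.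
Proof.
rewrite /der; under eq_bigr => c _ do rewrite rd_lf scalerA.
rewrite -scaler_suml; case: (i == j); congr (_ *: _).
  by apply: eq_bigr => c _; rewrite mulrC.
by rewrite big1 // => c _; rewrite mulr0.
Qed.

Lemma pol_lf a i j k : pol i j (lf a k) = if j == k then lf a i else 0.
Proof.
rewrite /pol; under eq_bigr => c _ do rewrite rd_lf -scalerAr mulr1.
by case: (j == k) => //; rewrite big1 // => c _; rewrite scale0r.
Qed.

Lemma cj_pol i j p : cj (pol i j p) = pol i j (cj p).
Proof.
by rewrite /pol cj_sum; apply: eq_bigr => c _; rewrite cjM cjX cj_deriv.
Qed.

Lemma cj_der a i p : cj (der a i p) = der (fun c => (a c)^*) i (cj p).
Proof.
by rewrite /der cj_sum; apply: eq_bigr => c _; rewrite cjZ cj_deriv.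
Qed.

Lemma dot_lf a i p q : dot (lf a i * p) q = dot p (der a i q).
Proof.
rewrite /lf /der mulr_suml dot_suml dot_sumr; apply: eq_bigr => c _.
by rewrite -scalerAl dotZl dotZr conjCK dot_rX.
Qed.

Lemma dot_lfr a i p q : dot p (lf a i * q) = dot (der a i p) q.
Proof. by rewrite dotC dot_lf -dotC. Qed.

End LinearForms.

Section Wick.
Variables (C : numClosedFieldType) (r N : nat).
Implicit Types (n : nat).

Definition ip (a b : 'I_N -> C) := \sum_c a c * (b c)^*.

Lemma big_lift_perm (V : nmodType) n (i j : 'I_n.+1) (f : 'S_n.+1 -> V) :
  \sum_(p : 'S_n.+1 | p i == j) f p = \sum_(p : 'S_n) f (lift_perm i j p).
Proof.
have lp_inj : injective (lift_perm i j : 'S_n -> 'S_n.+1).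
  move=> p q /permP e; apply/permP => k; apply: (@lift_inj _ j).
  by rewrite -!(lift_perm_lift i) e.
have ex (p : 'S_n.+1) : p i = j -> exists q : 'S_n, lift_perm i j q == p.
  move=> pij; pose g k := odflt k (unlift j (p (lift i k))).
  have gE k : lift j (g k) = p (lift i k).
    rewrite /g; case: unliftP => [k' -> //|e].
    have := neq_lift i k; rewrite -(inj_eq (@perm_inj _ p)) pij.
    by rewrite e eqxx.
  have g_inj : injective g.
    by move=> k k' e; apply: (@lift_inj _ i); apply: (@perm_inj _ p); rewrite -!gE e.
  exists (perm g_inj); apply/eqP/permP => k.
  case: (unliftP i k) => [k'|] ->; last by rewrite lift_perm_id pij.
  by rewrite lift_perm_lift permE gE.
rewrite (reindex (lift_perm i j)); last first.
  exists (fun p => odflt 1%g [pick q | lift_perm i j q == p]) => [q _|p].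
    case: pickP => [q' /eqP/lp_inj //|no].
    by have := no q; rewrite eqxx.
  rewrite inE => /eqP/ex [q0 q0P]; case: pickP => [q' /eqP //|no].
  by rewrite no in q0P.
by apply: eq_bigl => p; rewrite lift_perm_id eqxx.
Qed.

(** The first form acts on the other product as a derivative; the Leibniz rule is then the expansion
    of a permanent along its first row. *)
Lemma wick n (a b : 'I_n -> 'I_N -> C) (w v : 'I_n -> 'I_r.+1) :
  dot (\prod_x lf (a x) (w x)) (\prod_x lf (b x) (v x)) =
  \sum_(p : 'S_n) \prod_x (if w x == v (p x) then ip (a x) (b (p x)) else 0).
Proof.
elim: n a b w v => [|n IH] a b w v.
  rewrite !big_ord0 dot11 (big_pred1 1%g) => [|p]; first by rewrite big_ord0.
  by apply/esym/eqP/permP => -[].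
rewrite big_ord_recl dot_lf.
rewrite (leibniz_prod_in _ _ (der1 (a ord0) (w ord0)) (derM (a ord0) (w ord0))).
rewrite dot_sumr [RHS](partition_big (fun p : 'S_n.+1 => p ord0) predT) //=.
apply: eq_bigr => j _; rewrite der_lf -scalerAl mul1r dotZr.
have -> : \prod_(y | y != j) lf (b y) (v y) =
    \prod_(k < n) lf (b (lift j k)) (v (lift j k)) :> {mpoly C[_]}.
  rewrite (reindex_omap (lift j) (unlift j)) => [|y yj]; last first.
    by case: unliftP yj => [k -> //|->]; rewrite eqxx.
  by apply: eq_bigl => k; rewrite liftK eqxx eq_sym neq_lift.
rewrite big_lift_perm IH mulr_sumr; apply: eq_bigr => p _.
rewrite big_ord_recl lift_perm_id; congr (_ * _).
  case: (_ == _); rewrite ?conjC0 // rmorph_sum; apply: eq_bigr => c _.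
  by rewrite rmorphM /= conjCK mulrC.
by apply: eq_bigr => k _; rewrite lift_perm_lift.
Qed.
End Wick.

(** * Neuberger's identity *)

Section Neuberger.
Variables (C : numClosedFieldType) (r N : nat) (s : 'I_r.+1).
Hypothesis s0 : s != ord0.
Local Notation P := {mpoly C[#|{: 'I_r.+1 * 'I_N}|]}.
Implicit Types (p q u v y : P) (a b : 'I_N -> C) (l h : seq ('I_N -> C)).

Definition row0free p := forall c, rd ord0 c p = 0.

Definition lfs l i : P := \prod_(a <- l) lf a i.

Let conja a : 'I_N -> C := fun c => (a c)^*.

Lemma row0free_cj p : row0free p -> row0free (cj p).
Proof. by move=> hp c; rewrite /rd -cj_deriv [mderiv _ p]hp cj0. Qed.

Lemma row0free_der a i p : row0free p -> row0free (der a i p).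
Proof.
move=> hp c; rewrite /der linear_sum big1 // => e _.
by rewrite linearZ /= rdC hp linear0 scaler0.
Qed.

Lemma der0_free a p : row0free p -> der a ord0 p = 0.
Proof. by move=> hp; rewrite /der big1 // => e _; rewrite hp scaler0. Qed.

Lemma lap_free p : row0free p -> lap s p = 0.
Proof. by move=> hp; rewrite /lap big1 // => c _; rewrite rdC hp linear0. Qed.

Lemma lap_der a i p : lap s (der a i p) = der a i (lap s p).
Proof.
rewrite /der linear_sum; apply: eq_bigr => c _.
rewrite linearZ /=; congr (_ *: _); rewrite /lap linear_sum.
by apply: eq_bigr => e _ /=; rewrite (rdC i) (rdC i).
Qed.

Lemma iter_lap_der n a i p :
  iter n (lap s) (der a i p) = der a i (iter n (lap s) p).
Proof. by elim: n => //= n ->; rewrite lap_der. Qed.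

Lemma lap_lf a p : lap s (lf a ord0 * p) = lf a ord0 * lap s p + der (conja a) s p.
Proof.
rewrite /lap /der mulr_sumr -big_split; apply: eq_bigr => c _ /=.
rewrite rdM rd_lf (negPf s0) scale0r mul0r add0r rdM rd_lf eqxx conjCK.
by rewrite -scalerAl mul1r addrC.
Qed.

Lemma iter_lap_lf n a p : iter n.+1 (lap s) (lf a ord0 * p) =
  lf a ord0 * iter n.+1 (lap s) p + n.+1%:R *: der (conja a) s (iter n (lap s) p).
Proof.
elim: n => [|n IH]; first by rewrite /= lap_lf scale1r.
rewrite iterS IH linearD linearZ /= lap_lf lap_der -!iterS -addrA.
by rewrite -[X in _ + (X + _)]scale1r -scalerDl -[in RHS]natr1 [1 + _]addrC.
Qed.

Lemma iter_lap_lfs_eq0 n l p : row0free p -> (size l < n)%N ->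
  iter n (lap s) (lfs l ord0 * p) = 0.
Proof.
move=> hp; elim: l n => [|a l IH] [|n] //= ln.
  rewrite /lfs big_nil mul1r -iterS iterSr lap_free //.
  by elim: n {ln} => //= n ->; rewrite linear0.
rewrite -iterS /lfs big_cons -mulrA iter_lap_lf !IH ?linear0 ?mulr0 ?scaler0 ?addr0 //.
exact: ltnW.
Qed.

(* The exponential of lap s truncated below order K; the truncation is harmless
   because lap s is nilpotent on the polynomials considered. *)
Definition explap K p := \sum_(k < K) (k`!%:R)^-1 *: iter k (lap s) p.

Lemma explap_is_linear K : linear (explap K).
Proof.
move=> e p q; rewrite /explap scaler_sumr -big_split; apply: eq_bigr => k _ /=.
have -> : iter k (lap s) (e *: p + q) = e *: iter k (lap s) p + iter k (lap s) q.
  by elim: (k : nat) => //= n ->; rewrite linearP.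
by rewrite scalerDr !scalerA mulrC.
Qed.
HB.instance Definition _ K :=
  GRing.isLinear.Build C P P _ (explap K) (explap_is_linear K).

Lemma explap_der K a i p : explap K (der a i p) = der a i (explap K p).
Proof.
rewrite /explap linear_sum; apply: eq_bigr => k _.
by rewrite iter_lap_der linearZ.
Qed.

Lemma explapS K p : explap K.+1 p =
  p + \sum_(k < K) (k.+1`!%:R)^-1 *: iter k.+1 (lap s) p.
Proof.
by rewrite /explap big_ord_recl fact0 invr1 scale1r.
Qed.

(** The commutator of [lap s] with multiplication by a form of row 0 is a derivative in row s, which
    commutes with [lap s]; so the exponential adds just this derivative. The hypothesis makes orders
    K and K+1 of truncation agree on p. *)
Lemma explap_lf K a p : iter K (lap s) p = 0 ->
  explap K.+1 (lf a ord0 * p) =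
  lf a ord0 * explap K.+1 p + der (conja a) s (explap K.+1 p).
Proof.
move=> pK; rewrite [X in _ + der _ _ X](_ : _ = explap K p); last first.
  by rewrite /explap big_ord_recr /= pK scaler0 addr0.
rewrite !explapS mulrDr -addrA; congr (_ + _).
rewrite /explap mulr_sumr linear_sum -big_split; apply: eq_bigr => k _ /=.
rewrite -!iterS iter_lap_lf scalerDr -scalerAr; congr (_ + _).
rewrite scalerA linearZ /=; congr (_ *: _).
by rewrite factS natrM invfM mulrAC mulVf ?mul1r // pnatr_eq0.
Qed.

(** One expansion [t] serves all rows i, so a derivative taken in row s can be matched with one
    taken in row 0. *)
Lemma der_lfs a l : exists2 t : seq (C * seq ('I_N -> C)),
  all (fun e => size e.2 <= size l)%N t &
  forall i, der a i (lfs l i) = \sum_(e <- t) e.1 *: lfs e.2 i.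
Proof.
elim: l => [|b l [t t1 t2]].
  by exists [::] => // i; rewrite /lfs !big_nil der1.
exists ((\sum_c b c * (a c)^*, l) :: [seq (e.1, b :: e.2) | e <- t]).
  by rewrite /= leqnSn all_map.
move=> i; rewrite /lfs !big_cons big_map derM der_lf eqxx -scalerAl mul1r.
congr (_ + _); rewrite [der _ _ _]t2 mulr_sumr; apply: eq_bigr => e _ /=.
by rewrite -scalerAr big_cons.
Qed.

Lemma neuberger_base K l y u : row0free y -> row0free u -> (size l < K)%N ->
  dot y (lfs l s * u) = dot (cj u) (explap K (lfs l ord0 * cj y)).
Proof.
case: K => // K; elim: l y => [|a l IH] y hy hu.
  move=> _; rewrite /lfs !big_nil !mul1r explapS big1 ?addr0 ?dot_cj // => k _.
  by rewrite iterSr lap_free ?iter_fix ?linear0 ?scaler0 //; apply: row0free_cj.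
rewrite /= ltnS => lK; have hcy := row0free_cj hy; have hcu := row0free_cj hu.
rewrite /lfs !big_cons -!mulrA dot_lfr explap_lf ?iter_lap_lfs_eq0 //.
rewrite dotDr dot_lfr der0_free // dot0l add0r -explap_der derM.
rewrite -[der _ _ (\prod_(_ <- _) _)]/(der _ _ (lfs l ord0)).
have -> : der (conja a) s (lfs l ord0) = 0.
  elim: (l) => [|b l' IHl]; first by rewrite /lfs big_nil der1.
  rewrite /lfs big_cons derM der_lf [s == _](negPf s0) scale0r mul0r add0r.
  by rewrite [der _ _ _]IHl mulr0.
rewrite mul0r add0r -[der (conja a) s (cj y)](cj_der a s y) IH //.
  exact: row0free_der.
exact: ltnW.
Qed.

(** Induction on l: on the left its first form becomes a derivative, on the right [explap_lf] splits
    it in two. The derivative falling on [lfs l' s] matches the multiplication term, the one falling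
    on u the derivative term. *)
Lemma neuberger K l l' y u : row0free y -> row0free u ->
    (size l < K)%N -> (size l' < K)%N ->
  dot (lfs l s * y) (lfs l' s * u) =
  dot (explap K (lfs l ord0 * cj u)) (explap K (lfs l' ord0 * cj y)).
Proof.
elim: l l' y u => [|a l IH] l' y u hy hu.
  case: K => // K _ l'K; rewrite /lfs big_nil mul1r (@neuberger_base K.+1) //.
  rewrite big_nil mul1r (explapS K (cj u)) big1 ?addr0 // => k _.
  by rewrite iterSr lap_free ?iter_fix ?linear0 ?scaler0 //; apply: row0free_cj.
case: K IH => // K IH lK l'K; have hcy := row0free_cj hy; have hcu := row0free_cj hu.
rewrite {1 3}/lfs !big_cons -!mulrA dot_lf explap_lf ?iter_lap_lfs_eq0 //.
rewrite derM dotDr dotDl; congr (_ + _).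
  have [t t1 t2] := der_lfs a l'.
  rewrite -[der _ _ (\prod_(_ <- _) _)]/(der _ _ (lfs l' s)) t2.
  rewrite dot_lf -explap_der derM (der0_free _ hcy) mulr0 addr0.
  rewrite [der _ _ _]t2 !mulr_suml linear_sum !dot_sumr.
  elim: t t1 {t2} => [|e t IHt] /=; first by rewrite !big_nil.
  case/andP=> et /IHt {}IHt; rewrite !big_cons {}IHt; congr (_ + _).
  rewrite -!scalerAl linearZ !dotZr; congr (_ * _).
  by apply: IH => //; [apply: ltnW | apply: leq_ltn_trans l'K].
rewrite -explap_der derM.
have -> : der (conja a) s (lfs l ord0) = 0.
  elim: (l) => [|b l1 IHl]; first by rewrite /lfs big_nil der1.
  rewrite /lfs big_cons derM der_lf [s == _](negPf s0) scale0r mul0r add0r.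
  by rewrite [der _ _ _]IHl mulr0.
rewrite mul0r add0r -[der (conja a) s (cj u)](cj_der a s u).
apply: IH => //; [exact: row0free_der | exact: ltnW].
Qed.

Lemma pol00_lfs l y : row0free y ->
  pol ord0 ord0 (lfs l ord0 * cj y) = (size l)%:R *: (lfs l ord0 * cj y).
Proof.
move=> /row0free_cj hcy; have cy0 : pol ord0 ord0 (cj y) = 0.
  by rewrite /pol big1 // => c _; rewrite hcy mulr0.
rewrite polM cy0 mulr0 addr0 scalerAl; congr (_ * _).
elim: l => [|a l IHl]; first by rewrite /lfs big_nil pol1 scale0r.
rewrite /lfs big_cons polM pol_lf eqxx [pol _ _ (\prod_(_ <- _) _)]IHl.
by rewrite -scalerAr -[X in X + _]scale1r -scalerDl /= -nat1r.
Qed.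

(** The k-th contraction has degree [size l] - k in row 0, so contractions of different orders are
    orthogonal and the double sum is diagonal. *)
Lemma neuberger_norm l y : row0free y ->
  dot (lfs l s * y) (lfs l s * y) =
  \sum_(k < (size l).+1)
     dot (iter k (lap s) (lfs l ord0 * cj y)) (iter k (lap s) (lfs l ord0 * cj y))
     / (k`!%:R ^+ 2).
Proof.
move=> hy; rewrite (@neuberger (size l).+1) //; set F := _ * cj y.
have eF : pol ord0 ord0 F = (size l)%:R *: F by apply: pol00_lfs.
have ez k : pol ord0 ord0 (iter k (lap s) F) = ((size l)%:R - k%:R) *: iter k (lap s) F.
  elim: k => [|k IH]; first by rewrite subr0.
  rewrite iterS pol00_lap // IH linearZ /= -[X in _ - X]scale1r -scalerBl.
  by rewrite -addrA -opprD natr1.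
rewrite {1}/explap dot_suml; apply: eq_bigr => k _.
rewrite /explap dot_sumr (bigD1 k) //= big1 ?addr0 => [|k' k'k].
  rewrite dotZl dotZr fmorphV /= conjC_nat.
  by rewrite expr2 invfM mulrA mulrC; congr (_ * _); rewrite mulrC.
rewrite dotZl dotZr; suff -> : dot (iter k (lap s) F) (iter k' (lap s) F) = 0.
  by rewrite !mulr0.
have := dot_pol ord0 ord0 (iter k (lap s) F) (iter k' (lap s) F).
rewrite !ez dotZl dotZr rmorphB /= !conjC_nat => /eqP.
rewrite -subr_eq0 -mulrBl mulf_eq0 => /orP[|/eqP //].
rewrite (_ : _ - _ = k'%:R - k%:R); last by ring.
rewrite subr_eq0 eqr_nat => /eqP e.
by move: k'k; rewrite -(inj_eq val_inj) /= e eqxx.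
Qed.

End Neuberger.

(** * Letter exchanges as contractions *)

Section Exchange.
Variables (C : numClosedFieldType) (r N : nat).
Local Notation P := {mpoly C[#|{: 'I_r.+1 * 'I_N}|]}.
Implicit Types (p q u v y f g : P) (i j : 'I_r.+1) (I : seq 'I_r.+1).

Definition row0only p := forall i c, i != ord0 -> rd i c p = 0.

Definition pol_up I p := foldr (fun i => pol i ord0) p I.
Definition pol_dn I p := foldr (fun i => pol ord0 i) p I.

Let nz I := all (fun i => i != ord0) I.

Lemma rd0_pol_up I c p : nz I -> rd ord0 c (pol_up I p) = pol_up I (rd ord0 c p).
Proof.
elim: I => //= i I IH /andP[i0 I0].
by rewrite rd_pol eq_sym (negPf i0) add0r IH.
Qed.

Lemma rd_pol_dn I i c p : i != ord0 -> rd i c (pol_dn I p) = pol_dn I (rd i c p).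
Proof.
by move=> i0; elim: I => //= j I IH; rewrite rd_pol (negPf i0) add0r IH.
Qed.

Lemma rdiC_free i c p : row0free p -> row0free (rd i c p).
Proof. by move=> hp e; rewrite rdC hp linear0. Qed.

Lemma rd0C_only c p : row0only p -> row0only (rd ord0 c p).
Proof. by move=> hp i e i0; rewrite rdC hp // linear0. Qed.

Lemma partial_transpose f g u y : row0only f -> row0only g ->
  row0free u -> row0free y -> dot (f * u) (g * y) = dot (f * cj y) (g * cj u).
Proof.
move=> hf hg hu hy.
pose zr (v : 'I_#|{: 'I_r.+1 * 'I_N}|) := (enum_val v).1 == ord0.
apply: (@dot_partial_transpose C _ zr).
- by move=> v v0; have := hf _ (enum_val v).2 v0; rewrite /rd /rvar -surjective_pairing enum_valK.
- by move=> v v0; have := hg _ (enum_val v).2 v0; rewrite /rd /rvar -surjective_pairing enum_valK.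
- by move=> v /eqP v0; have := hu (enum_val v).2; rewrite /rd /rvar -v0 -surjective_pairing enum_valK.
- by move=> v /eqP v0; have := hy (enum_val v).2; rewrite /rd /rvar -v0 -surjective_pairing enum_valK.
Qed.

Lemma lap_split i f y : i != ord0 -> row0only f -> row0free y ->
  lap i (f * cj y) = \sum_e rd ord0 e f * cj (rd i e y).
Proof.
move=> i0 hf hy; apply: eq_bigr => e _.
rewrite rdM hf // mul0r add0r rdM rdC [rd ord0 _ (cj y)](row0free_cj hy).
by rewrite linear0 mulr0 addr0 [in RHS]/rd cj_deriv.
Qed.

(* Exchanging letters between row 0 and the other rows becomes, after partial
   conjugation, a contraction of row 0 with these rows. *)
Lemma exchange_dot I f g u y : nz I -> row0only f -> row0only g ->
    row0free u -> row0free y ->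
  dot (f * u) (pol_up I g * pol_dn I y) =
  dot (laps I (f * cj y)) (laps I (g * cj u)).
Proof.
elim: I f g u y => [|i I IH] f g u y /=; first by move=> _; apply: partial_transpose.
case/andP=> i0 I0 hf hg hu hy; rewrite -!laps_lap !lap_split //.
have -> : pol i ord0 (pol_up I g) = \sum_c rX C i c * pol_up I (rd ord0 c g).
  by apply: eq_bigr => c _; rewrite rd0_pol_up.
have -> : pol ord0 i (pol_dn I y) = \sum_e rX C ord0 e * pol_dn I (rd i e y).
  by apply: eq_bigr => c _; rewrite rd_pol_dn.
rewrite !linear_sum dot_sumr mulr_suml dot_sumr; apply: eq_bigr => c _.
rewrite mulr_sumr dot_suml dot_sumr; apply: eq_bigr => e _ /=.
rewrite mulrACA -[X in dot _ X]mulrA !dot_rXr.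
rewrite (rdM i) hf // mul0r add0r rdM (rdiC_free i c hu) mulr0 addr0.
by apply: IH => //; [exact: rd0C_only|exact: rd0C_only|exact: rdiC_free|exact: rdiC_free].
Qed.
End Exchange.

(** * Swapping boxes between the merged row and the rows below *)

Section Swaps.
Variables (n : nat) (T : {set 'I_n}).

(* The tests on s t and s x make the k successive transpositions use distinct boxes. *)
Fixpoint swaps (V : nmodType) k (h : 'S_n -> V) (s : 'S_n) : V :=
  if k is k'.+1 then
    \sum_(t in T | s t \in T) \sum_(x in ~: T | s x \notin T)
      swaps k' h (tperm x t * s)%g
  else h s.

Lemma swaps_morph (V W : nmodType) (F : V -> W) k h s :
    F 0 = 0 -> {morph F : x y / x + y} ->
  F (swaps k h s) = swaps k (fun s => F (h s)) s.
Proof.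
move=> F0 FD; elim: k s => //= k IH s.
rewrite (big_morph F FD F0); apply: eq_bigr => t _.
by rewrite (big_morph F FD F0); apply: eq_bigr => x _.
Qed.

Lemma eq_swaps (V : nmodType) k (h h' : 'S_n -> V) s :
  h =1 h' -> swaps k h s = swaps k h' s.
Proof.
move=> e; elim: k s => //= k IH s.
by apply: eq_bigr => t _; apply: eq_bigr => x _.
Qed.

Lemma swaps_sum (V : nmodType) (J : Type) (rs : seq J) (Q : pred J) k
    (h : J -> 'S_n -> V) s :
  \sum_(j <- rs | Q j) swaps k (h j) s =
  swaps k (fun s => \sum_(j <- rs | Q j) h j s) s.
Proof.
elim: k s => //= k IH s; rewrite exchange_big; apply: eq_bigr => t _ /=.
by rewrite exchange_big; apply: eq_bigr => x _ /=.
Qed.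

End Swaps.

Section Words.
Variables (C : numClosedFieldType) (r N n : nat).
Local Notation P := {mpoly C[#|{: 'I_r.+1 * 'I_N}|]}.
Variables (a : 'I_n -> 'I_N -> C) (T : {set 'I_n}) (Q : seq 'I_r.+1).
Hypotheses (Q_uniq : uniq Q) (Q0 : all (fun i => i != ord0) Q).
Implicit Types (w : 'I_n -> 'I_r.+1) (i j : 'I_r.+1) (I : seq 'I_r.+1) (p : P).

Definition word_prod (A : {set 'I_n}) w : P := \prod_(x in A) lf (a x) (w x).

Lemma eq_word_prod (A : {set 'I_n}) w w' :
  {in A, w =1 w'} -> word_prod A w = word_prod A w'.
Proof. by move=> e; apply: eq_bigr => x xA; rewrite e. Qed.

Lemma pol_word_prod i j A w : pol i j (word_prod A w) =
  \sum_(x in A | w x == j) word_prod A (fun y => if y == x then i else w y).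
Proof.
rewrite /word_prod (leibniz_prod_in _ _ (pol1 C N i j) (@polM _ _ _ i j)).
rewrite big_mkcondr; apply: eq_bigr => x xA; rewrite pol_lf eq_sym.
case: (w x == j); last by rewrite mul0r.
rewrite [RHS](bigD1 x) //= eqxx; congr (_ * _).
by apply: eq_bigr => y /andP[_ /negPf->].
Qed.

Lemma pol_up_pol i I p : i != ord0 -> all (fun i => i != ord0) I ->
  pol_up I (pol i ord0 p) = pol i ord0 (pol_up I p).
Proof.
move=> i0; elim: I => //= j I IH /andP[j0 I0].
by rewrite IH // pol_comm ![ord0 == _]eq_sym (negPf i0) (negPf j0) addr0 subr0.
Qed.

Lemma pol_dn_pol i I p : i != ord0 -> all (fun i => i != ord0) I ->
  pol_dn I (pol ord0 i p) = pol ord0 i (pol_dn I p).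
Proof.
move=> i0; elim: I => //= j I IH /andP[j0 I0].
by rewrite IH // pol_comm (negPf i0) (negPf j0) addr0 subr0.
Qed.

Lemma pol_up_sum J (rs : seq J) (R : pred J) (F : J -> P) I :
  pol_up I (\sum_(j <- rs | R j) F j) = \sum_(j <- rs | R j) pol_up I (F j).
Proof. by elim: I => //= i I ->; rewrite linear_sum. Qed.

Lemma pol_dn_sum J (rs : seq J) (R : pred J) (F : J -> P) I :
  pol_dn I (\sum_(j <- rs | R j) F j) = \sum_(j <- rs | R j) pol_dn I (F j).
Proof. by elim: I => //= i I ->; rewrite linear_sum. Qed.

Definition exch k w : P :=
  \sum_(I <- words Q k) pol_up I (word_prod T w) * pol_dn I (word_prod (~: T) w).

Lemma eq_exch k w w' : w =1 w' -> exch k w = exch k w'.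
Proof.
by move=> e; rewrite /exch (@eq_word_prod T w w') // (@eq_word_prod (~: T) w w').
Qed.

Lemma exch0 w : exch 0 w = \prod_x lf (a x) (w x).
Proof.
rewrite /exch big_seq1 /= /word_prod [RHS](bigID (mem T)) /=; congr (_ * _).
by apply: eq_bigl => x; rewrite inE.
Qed.

(** [pol i ord0] relabels a box t of T from 0 to i, and [pol ord0 i] a box x outside T from i to 0.
    Summed over i, the pairs are exactly the exchanges of the labels of t and x. *)
Lemma exchS k w : (forall x, w x != ord0 -> w x \in Q) ->
  exch k.+1 w = \sum_(t in T | w t == ord0) \sum_(x in ~: T | w x != ord0)
     exch k (fun y => w (tperm x t y)).
Proof.
move=> wQ; rewrite /exch big_words.
transitivity (\sum_(i <- Q) \sum_(I <- words Q k)
  \sum_(t in T | w t == ord0) \sum_(x in ~: T | w x != ord0)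
    if i == w x then
    pol_up I (word_prod T (fun y => w (tperm x t y))) *
    pol_dn I (word_prod (~: T) (fun y => w (tperm x t y))) else 0).
  apply: eq_big_seq => i iQ; apply: eq_big_seq => I.
  rewrite mem_words => /andP[_ /allP IQ] /=.
  have i0 : i != ord0 by apply: (allP Q0).
  have I0 : all (fun i => i != ord0) I by apply/allP => j /IQ; apply: (allP Q0).
  rewrite -pol_up_pol // -pol_dn_pol // !pol_word_prod pol_up_sum pol_dn_sum.
  rewrite mulr_suml; apply: eq_bigr => t /andP[tT /eqP wt].
  rewrite mulr_sumr [RHS](bigID (fun x => w x == i)) /= [X in _ = _ + X]big1; last first.
    by move=> x /andP[_ /negPf]; rewrite eq_sym => ->.
  rewrite addr0; apply: eq_big => [x|x /andP[]].
    case: eqP => [->|_]; rewrite ?andbF // i0 !andbT //.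
  rewrite inE => xT /eqP wx; rewrite wx eqxx.
  have xt : (x == t) = false by apply: contraNF xT => /eqP ->.
  congr (pol_up I _ * pol_dn I _); apply: eq_word_prod => y.
    move=> yT; case: tpermP => [yx|->|yx /eqP/negPf -> //]; rewrite ?eqxx //.
    by rewrite yx (negPf xT) in yT.
  rewrite inE => yT; case: tpermP => [->|yt|/eqP/negPf -> //]; rewrite ?eqxx ?wt //.
  by rewrite yt tT in yT.
under eq_bigr => i _ do rewrite exchange_big.
rewrite exchange_big /=; apply: eq_bigr => t _.
under eq_bigr => i _ do rewrite exchange_big.
rewrite exchange_big /=; apply: eq_bigr => x /andP[_ wx].
rewrite exchange_big /=; apply: eq_bigr => I _.
exact: (big_pick (fun _ => _) Q_uniq (wQ x wx)).
Qed.

End Words.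

Section Symmetrized.
Variables (C : numClosedFieldType) (r N n : nat) (B : 'I_n -> 'I_N -> C).
Variables (rho : 'I_n -> 'I_r.+1) (Kp : {group 'S_n}) (Q : seq 'I_r.+1).
Hypotheses (Q_uniq : uniq Q) (Q0 : all (fun i => i != ord0) Q).
Hypothesis rhoQ : forall x, rho x != ord0 -> rho x \in Q.
Let T := [set x | rho x == ord0].
Hypothesis KpT : forall c t, c \in Kp -> t \in T -> c t = t.
Implicit Types (tau s c : 'S_n).
Local Notation P := {mpoly C[#|{: 'I_r.+1 * 'I_N}|]}.

Definition sg s : C := (-1) ^+ odd_perm s.

Definition mono tau : P := \prod_x lf (B (tau x)) (rho x).
Definition bidet tau : P := \sum_(c in Kp) sg c *: mono (c * tau)%g.
Definition topf tau : P := \prod_(t in T) lf (B (tau t)) ord0.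
(** Here c permutes the row labels and leaves the vectors in place, so that polarizations act on
    labels alone. *)
Definition bidetS tau : P :=
  \sum_(c in Kp) sg c *: word_prod (fun x => B (tau x)) (~: T) (fun x => rho (c x)).

Lemma Kp_T c x : c \in Kp -> (c x \in T) = (x \in T).
Proof.
move=> cK; apply/idP/idP => [cx|/KpT-> //].
by have := KpT (groupVr cK) cx; rewrite permK => ->.
Qed.

Lemma monoM s tau :
  mono (s * tau)%g = \prod_x lf (B (tau x)) (rho (s^-1%g x)).
Proof.
rewrite /mono (reindex_inj (@perm_inj _ s^-1%g)) /=; apply: eq_bigr => x _.
by rewrite permM permKV.
Qed.

Lemma bidet_split tau : bidet tau = topf tau * bidetS tau.
Proof.
rewrite /bidet /bidetS mulr_sumr (big_invg Kp); apply: eq_bigr => c cK.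
rewrite -scalerAr monoM /sg odd_permV invgK; congr (_ *: _).
rewrite (bigID (mem T)) /=; congr (_ * _).
  by apply: eq_bigr => x xT; rewrite (KpT cK xT); move: xT; rewrite inE => /eqP->.
by apply: eq_bigl => x; rewrite !inE.
Qed.

Lemma exch_bidet tau k :
  \sum_(I <- words Q k) pol_up I (topf tau) * pol_dn I (bidetS tau) =
  swaps T k (fun s => bidet (s^-1 * tau)%g) 1%g.
Proof.
pose a x := B (tau x).
transitivity (\sum_(c in Kp) sg c *: exch a T Q k (fun x => rho (c x))).
  rewrite /exch; under [RHS]eq_bigr => c _ do rewrite scaler_sumr.
  rewrite [RHS]exchange_big; apply: eq_bigr => I _.
  rewrite /bidetS pol_dn_sum mulr_sumr; apply: eq_bigr => c cK.
  have -> p : pol_dn I (sg c *: p) = sg c *: pol_dn I p.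
    by elim: I p => //= i I IH p; rewrite IH linearZ.
  rewrite -scalerAr; congr (_ *: (pol_up I _ * _)).
  by apply: eq_bigr => x xT; rewrite (KpT cK xT); move: xT; rewrite inE => /eqP->.
transitivity (\sum_(c in Kp) swaps T k
    (fun s => sg c *: \prod_x lf (a x) (rho (c (s x)))) 1%g).
  apply: eq_bigr => c cK.
  transitivity (sg c *: exch a T Q k (fun x => rho (c ((1 : 'S_n)%g x)))).
    by congr (_ *: _); apply: eq_exch => x; rewrite perm1.
  elim: k (1%g : 'S_n) => [|k IH] s; first by rewrite exch0.
  rewrite exchS // => [|x]; last exact: rhoQ.
  rewrite scaler_sumr /=; apply: eq_big => [t|t _].
    by rewrite -[s t \in T](Kp_T _ cK) [c _ \in T]inE.
  rewrite scaler_sumr /=; apply: eq_big => [x|x _].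
    by rewrite -[s x \in T](Kp_T _ cK) [c _ \in T]inE.
  rewrite -IH; congr (_ *: _); apply: eq_exch => y.
  by rewrite permM.
rewrite swaps_sum; apply: eq_swaps => s; rewrite /bidet [RHS](big_invg Kp).
apply: eq_bigr => c cK; rewrite /sg odd_permV mulgA monoM -invMg invgK.
by congr (_ *: _); apply: eq_bigr => x _; rewrite permM.
Qed.

Lemma bidetS_free tau : row0free (bidetS tau).
Proof.
move=> e; rewrite /bidetS linear_sum big1 // => c cK; rewrite linearZ /=.
rewrite /word_prod (leibniz_prod_in _ _ (rd1 C _ e) (@rdM _ _ _ _ e)) big1 ?scaler0 //.
move=> x; rewrite inE => xT; rewrite rd_lf -[x \in T](Kp_T _ cK) inE in xT *.
by rewrite eq_sym (negPf xT) scale0r mul0r.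
Qed.

Lemma topf_only tau : row0only (topf tau).
Proof.
move=> i e i0; rewrite /topf (leibniz_prod_in _ _ (rd1 C _ e) (@rdM _ _ _ _ e)).
by rewrite big1 // => x _; rewrite rd_lf (negPf i0) scale0r mul0r.
Qed.

(** The F of a merge, where tau tells which vector sits in which box. *)
Definition mixed tau := topf tau * cj (bidetS tau).

Lemma contract_mixed tau k : contract Q k (mixed tau) =
  swaps T k (fun s => dot (bidet tau) (bidet (s^-1 * tau)%g)) 1%g.
Proof.
rewrite -(swaps_morph T k (fun s => bidet (s^-1 * tau)%g) 1%g (dot0r _)); last first.
  by move=> p q; rewrite dotDr.
rewrite -exch_bidet dot_sumr bidet_split /contract; apply: eq_big_seq => I.
rewrite mem_words => /andP[_ IQ]; rewrite exchange_dot //.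
- by apply/allP => i /(allP IQ); apply: (allP Q0).
- exact: topf_only.
- exact: topf_only.
- exact: bidetS_free.
- exact: bidetS_free.
Qed.

End Symmetrized.

(** * Column permutations sorted by the boxes sent into row 0 *)

Section Crossing.
Variables (n : nat) (T : {set 'I_n}).
Implicit Types (s h c q : 'S_n) (X Y : {set 'I_n}) (x t : 'I_n).

(** Images of the boxes of T are left free: they are irrelevant for functions invariant under
    permutations of T. *)
Definition crossing X s :=
  [forall x, (x \notin T) ==> if x \in X then s x \in T else s x == x].

Lemma crossingP X s :
  reflect (forall x, x \notin T -> if x \in X then s x \in T else s x == x)
          (crossing X s).
Proof.
by apply: (iffP forallP) => h x; [move=> xT; have := h x; rewrite xT | apply/implyP/h].
Qed.

Definition fixC h := forall x, x \notin T -> h x = x.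

Lemma fixC_T h x : fixC h -> (h x \in T) = (x \in T).
Proof.
move=> hT; apply/idP/idP => [|xT]; first by apply: contraLR => xT; rewrite hT.
apply: contraT => hx; have := hT _ hx => /perm_inj e.
by rewrite e xT in hx.
Qed.

Lemma crossing_transport X s s' l : crossing X s -> crossing X s' ->
    uniq l -> (forall x, x \in l -> (x \notin T) && (x \in X)) ->
  exists h, fixC h /\ {in l, forall x, h (s x) = s' x}.
Proof.
move=> /crossingP cs /crossingP cs'; elim: l => [|x0 l IH] /=.
  by exists 1%g; split=> // x _; rewrite perm1.
case/andP=> x0l ul lX; have [|h [hT hl]] := IH ul.
  by move=> x xl; apply: lX; rewrite inE xl orbT.
have /andP[x0T x0X] := lX x0 (mem_head _ _).
have sx0 := cs _ x0T; have s'x0 := cs' _ x0T; rewrite x0X in sx0 s'x0.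
exists (h * tperm (h (s x0)) (s' x0))%g; split=> [x xT|x].
  rewrite permM (hT x xT) tpermD //; apply: contraNneq xT => <- //.
  by rewrite fixC_T.
rewrite inE permM => /predU1P[->|xl]; first by rewrite tpermL.
have x0x : x0 != x by apply: contraNneq x0l => ->.
rewrite (hl x xl) tpermD // ?(inj_eq perm_inj) //.
by rewrite -(hl x xl) !(inj_eq perm_inj).
Qed.

Lemma card_crossing X s : crossing X s -> X \subset ~: T ->
  #|[set t in T | s t \in T]| = (#|T| - #|X|)%N.
Proof.
move=> /crossingP cs XT.
have e : s @^-1: T = X :|: [set t in T | s t \in T].
  apply/setP => x; rewrite !inE; case: (boolP (x \in T)) => xT /=.
    case: (boolP (x \in X)) => // xX.
    by have := subsetP XT x xX; rewrite inE xT.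
  by rewrite orbF; have := cs x xT; case: (x \in X) => [->|/eqP->] //; apply: negbTE.
have := cardsUI X [set t in T | s t \in T]; rewrite -e card_preimset; last exact: perm_inj.
rewrite (_ : _ :&: _ = set0) ?cards0 ?addn0 => [->|]; first by rewrite addKn.
apply/setP => x; rewrite !inE; apply/and3P => -[xX xT _].
by have := subsetP XT x xX; rewrite inE xT.
Qed.

Lemma crossing1 : crossing set0 1.
Proof. by apply/crossingP => x xT; rewrite inE perm1. Qed.

Lemma crossing_tperm X s x t : crossing X s -> t \in T -> s t \in T ->
  x \notin T -> crossing (x |: X) (tperm x t * s)%g.
Proof.
move=> /crossingP cs tT stT xT; apply/crossingP => y yT.
rewrite !inE permM; case: eqP => [->|/eqP yx] /=; first by rewrite tpermL.
have yt : t != y by apply: contraNneq yT => <-.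
by rewrite (tpermD _ yt) ?cs // eq_sym.
Qed.

Variables (C : numFieldType) (g : 'S_n -> C).
Hypothesis gl : forall h s, fixC h -> g (h * s)%g = g s.
Hypothesis gr : forall h s, fixC h -> g (s * h)%g = g s.

(* By [crossvalE] the choice of s is immaterial; the value is 0 if no permutation
   crosses at X. *)
Definition crossval X : C := if [pick s | crossing X s] is Some s then g s else 0.

(** Two permutations crossing at X agree outside T after right multiplication by a permutation of T,
    and then differ by one on the left. *)
Lemma crossvalE X s : crossing X s -> g s = crossval X.
Proof.
move=> cs; rewrite /crossval; case: pickP => [s' cs'|no]; last by have := no s; rewrite cs.
have [||h [hT hs]] := @crossing_transport X s s' (enum (X :\: T)) cs cs'.
- exact: enum_uniq.
- by move=> x; rewrite mem_enum inE.
have agree : forall x, x \notin T -> h (s x) = s' x.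
  move=> x xT; case: (boolP (x \in X)) => xX.
    by apply: hs; rewrite mem_enum inE xT.
  have /crossingP/(_ x xT) := cs; have /crossingP/(_ x xT) := cs'.
  by rewrite (negPf xX) => /eqP-> /eqP->; apply: hT.
have fx : fixC (s' * (s * h)^-1)%g.
  move=> x xT; rewrite permM; apply: (@perm_inj _ (s * h)%g).
  by rewrite permKV permM agree.
by rewrite -(gr s hT) -(gl (s * h)%g fx) mulgKV.
Qed.

Lemma crossval_eq0 X : X \subset ~: T -> (#|T| < #|X|)%N -> crossval X = 0.
Proof.
move=> XT XltT; rewrite /crossval; case: pickP => // s /crossingP cs.
have : (#|s @: X| <= #|T|)%N.
  apply: subset_leq_card; apply/subsetP => _ /imsetP[x xX ->].
  have := subsetP XT x xX; rewrite inE => xT.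
  by have := cs x xT; rewrite xX.
rewrite card_imset; last exact: perm_inj.
by rewrite leqNgt XltT.
Qed.

(** Every swap adds one box x to X, and its partner t is any of the boxes of T still mapped into T.
    The added boxes can come in k! orders, the partners be chosen in (|T| - |X|)^_k ways. *)
Lemma swaps_crossing k X s : crossing X s -> X \subset ~: T ->
  swaps T k g s = (k`! * (#|T| - #|X|) ^_ k)%:R *
    \sum_(Y : {set 'I_n} | [&& X \subset Y, Y \subset ~: T & #|Y| == (#|X| + k)%N]) crossval Y.
Proof.
elim: k X s => [|k IH] X s cs XT.
  rewrite mul1r /= (big_pred1 X) => [|Y]; first exact: crossvalE.
  rewrite addn0 /=; apply/and3P/eqP => [[XY _ /eqP cY]|->]; last by rewrite XT.
  by apply/esym/eqP; rewrite eqEcard XY cY leqnn.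
rewrite /=.
pose W x := \sum_(Y : {set 'I_n} | [&& x |: X \subset Y, Y \subset ~: T
   & #|Y| == (#|X| + k.+1)%N]) crossval Y.
transitivity (\sum_(t in T | s t \in T)
   ((k`! * (#|T| - #|X|.+1) ^_ k)%:R * \sum_(x in ~: T | s x \notin T) W x)).
  apply: eq_bigr => t /andP[tT stT]; rewrite mulr_sumr.
  apply: eq_bigr => x; rewrite inE => /andP[xT sxT].
  have xX : x \notin X.
    by apply: contra sxT => xX; have /crossingP/(_ x xT) := cs; rewrite xX.
  rewrite (IH (x |: X)) ?crossing_tperm // ?cardsU1 ?xX ?add1n ?addSnnS //.
  by rewrite subUset sub1set inE xT.
rewrite sumr_const.
have -> : #|[pred t in T | s t \in T]| = (#|T| - #|X|)%N.
  by rewrite -(card_crossing cs XT); apply: eq_card => t; rewrite !inE.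
rewrite /W (exchange_big_dep (fun Y : {set 'I_n} =>
   [&& X \subset Y, Y \subset ~: T & #|Y| == (#|X| + k.+1)%N])) /=; last first.
  move=> x Y _ /and3P[]; rewrite subUset => /andP[_ ->] -> ->.
  by [].
rewrite (eq_bigr (fun Y => k.+1%:R * crossval Y)) => [|Y /and3P[XY YT /eqP cY]].
  rewrite -mulr_sumr mulrA -mulrnAl; congr (_ * _).
  by rewrite -mulr_natl -!natrM factS ffactnS subnS; congr _%:R; ring.
rewrite sumr_const [RHS]mulr_natl; congr (_ *+ _).
rewrite -[RHS](addKn #|X|) -cY -cardsDS //; apply: eq_card => x; rewrite unfold_in /= !inE.
rewrite YT cY eqxx !andbT subUset XY andbT sub1set.
case: (boolP (x \in Y)) => [xY|_]; rewrite ?andbF // andbT.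
have xT : x \notin T by have := subsetP YT x xY; rewrite inE.
rewrite xT /= andbT; have /crossingP/(_ x xT) := cs.
by case: (x \in X) => [->|/eqP ->].
Qed.

Section Columns.
Variables (K Kp : {group 'S_n}).
Hypothesis K_T : forall q t, q \in K -> t \in T -> q t \in T -> q t = t.
Hypothesis K_col : forall x, x \notin T -> exists2 t, t \in T & tperm x t \in K.
Hypothesis KpP : forall c, (c \in Kp) = (c \in K) && [forall t in T, c t == t].

Let sgn s : C := (-1) ^+ odd_perm s.
Hypothesis gKl : forall c s, c \in Kp -> g (c * s)%g = sgn c * g s.
Hypothesis gKr : forall c s, c \in Kp -> g (s * c)%g = sgn c * g s.

Definition crossed q := [set x in ~: T | q x \in T].

Lemma K_tperm q x : q \in K -> x \notin T -> q x \in T -> tperm x (q x) \in K.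
Proof.
move=> qK xT qxT; have [t tT xtK] := K_col xT.
have e : (q^-1 * tperm x t)%g (q x) = t by rewrite permM permK tpermL.
have := K_T (groupM (groupVr qK) xtK) qxT; rewrite e => /(_ tT) <-.
by [].
Qed.

Lemma col_uniq x t t' : x \notin T -> t \in T -> t' \in T ->
  tperm x t \in K -> tperm x t' \in K -> t = t'.
Proof.
move=> xT tT t'T xt xt'.
have e : (tperm x t * tperm x t')%g t = t' by rewrite permM tpermR tpermL.
by have := K_T (groupM xt xt') tT; rewrite e => /(_ t'T) ->.
Qed.

Lemma Kp_fix c t : c \in Kp -> t \in T -> c t = t.
Proof. by rewrite KpP => /andP[_ /forall_inP cT] /cT/eqP. Qed.

Lemma K_T_back q t : q \in K -> t \in T -> q t \notin T ->
  exists2 x, x \in crossed q & q x = t.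
Proof.
move=> qK tT qtT; exists (q^-1%g t); last by rewrite permKV.
rewrite !inE permKV tT andbT; apply: contra qtT => xT.
have := K_T qK xT; rewrite permKV => /(_ tT) e.
by rewrite [X in q X]e permKV.
Qed.

Lemma crossed_mem q x : q \in K -> x \in crossed q ->
  [/\ x \notin T, q x \in T & tperm x (q x) \in K].
Proof. by move=> qK; rewrite !inE => /andP[xT qxT]; rewrite K_tperm. Qed.

(** The factor s is a product of the transpositions of x with q x, one for every crossed box x,
    whence the sign; what remains fixes T. *)
Lemma K_decomp q : q \in K -> exists s c,
  [/\ q = (s * c)%g, c \in Kp, crossing (crossed q) s & sgn s = (-1) ^+ #|crossed q|].
Proof.
have [d] := ubnP #|crossed q|; elim: d q => // d IH q; rewrite ltnS => cq qK.
have [c0|[x xq]] := set_0Vmem (crossed q).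
  exists 1%g, q; rewrite mul1g c0 cards0 /sgn odd_perm1 crossing1; split=> //.
  rewrite KpP qK; apply/forall_inP => t tT; apply/eqP/K_T => //.
  apply: contraT => /(K_T_back qK tT) [x].
  by rewrite c0 inE.
have [xT qxT xK] := crossed_mem qK xq; set t := q x in qxT xK.
have xt : x != t by apply: contraNneq xT => ->.
pose q' := (tperm x t * q)%g; have q'K : q' \in K by rewrite groupM.
have q't : q' t = t by rewrite permM tpermR.
have qtT : q t \notin T.
  apply: contra xT => /(K_T qK qxT) e.
  by have /perm_inj -> : q x = q t by rewrite e.
have cq' : crossed q' = crossed q :\ x.
  apply/setP => y; rewrite !inE permM; case: (eqVneq y x) => [->|yx] /=.
    by rewrite tpermL (negPf qtT) andbF.
  case: (boolP (y \in T)) => //= yT; rewrite tpermD // 1?eq_sym //.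
  by apply: contraNneq yT => ->.
have card' : #|crossed q| = #|crossed q'|.+1 by rewrite cq' (cardsD1 x (crossed q)) xq.
have [|s [c [e cK cs ss]]] := IH q' _ q'K; first by rewrite -card'.
have st : s t = t.
  apply: (@perm_inj _ c); rewrite (Kp_fix cK qxT) -[RHS]q't e permM.
  by [].
exists (tperm x t * s)%g, c; split=> //.
- by rewrite -mulgA -e mulgA tperm2 mul1g.
- by rewrite -(setD1K xq) -cq'; apply: crossing_tperm => //; rewrite st.
- by rewrite /sgn odd_permM odd_tperm xt signr_addb -/(sgn s) ss card' exprS.
Qed.

Lemma K_term q : q \in K ->
  sgn q * g q = (-1) ^+ #|crossed q| * crossval (crossed q).
Proof.
move=> qK; have [s [c [e cK cs ss]]] := K_decomp qK.
rewrite -(crossvalE cs) {1 2}e gKr // -ss /sgn odd_permM signr_addb.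
by rewrite -mulrA signrMK.
Qed.

Lemma crossed_mulr q c : c \in Kp -> crossed (q * c)%g = crossed q.
Proof.
move=> cK; apply/setP => x; rewrite !inE permM; congr (_ && _).
apply/idP/idP => [cx|qx]; last by rewrite (Kp_fix cK).
by have := Kp_fix (groupVr cK) cx; rewrite permK => ->.
Qed.

Lemma crossed_fiber q q0 : q0 \in K -> q \in K -> crossed q = crossed q0 ->
  (q0^-1 * q)%g \in Kp.
Proof.
move=> q0K qK e; rewrite KpP groupM ?groupV //.
apply/forall_inP => t tT; apply/eqP; rewrite permM.
set x := q0^-1%g t; have q0x : q0 x = t by rewrite permKV.
have [xT|xT] := boolP (x \in T); last first.
  have xq0 : x \in crossed q0 by rewrite !inE xT q0x.
  have [_ _ k0] := crossed_mem q0K xq0; rewrite -e in xq0.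
  have [_ qxT k1] := crossed_mem qK xq0; rewrite q0x in k0.
  exact: (col_uniq xT).
have xt : x = t by rewrite -q0x K_T // q0x.
rewrite xt; apply: K_T => //; apply: contraT => /(K_T_back qK tT) [y yq qy].
have [yT _ k1] := crossed_mem qK yq; rewrite e in yq.
have [_ q0y k0] := crossed_mem q0K yq; rewrite qy in k1.
have /perm_inj e1 : q0 y = q0 x by rewrite q0x (col_uniq yT q0y tT).
by rewrite e1 xt tT in yT.
Qed.

Lemma card_crossed q0 : q0 \in K ->
  #|[set q in K | crossed q == crossed q0]| = #|Kp|.
Proof.
move=> q0K; rewrite -(card_lcoset Kp q0); apply: eq_card => q.
rewrite inE mem_lcoset; apply/andP/idP => [[qK /eqP]|qKp].
  exact: crossed_fiber.
rewrite -(mulKVg q0 q) crossed_mulr // eqxx groupM //.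
by move: qKp; rewrite KpP => /andP[].
Qed.

Lemma crossed_exists X : X \subset ~: T ->
    (forall x x' t, x \in X -> x' \in X -> t \in T ->
       tperm x t \in K -> tperm x' t \in K -> x = x') ->
  exists2 q, q \in K & crossed q = X.
Proof.
have [d] := ubnP #|X|; elim: d X => // d IH X; rewrite ltnS => cX XT Xinj.
have [->|[x xX]] := set_0Vmem X.
  exists 1%g; first exact: group1.
  by apply/setP => x; rewrite !inE perm1; case: (x \in T).
have xT : x \notin T by have := subsetP XT x xX; rewrite inE.
have [t tT xtK] := K_col xT.
have [||y y' t' |q1 q1K q1X] := IH (X :\ x).
- by move: cX; rewrite (cardsD1 x X) xX.
- by apply: subset_trans XT; apply: subsetDl.
- by rewrite !inE => /andP[_ yX] /andP[_ y'X]; apply: Xinj.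
have q1t : q1 t = t.
  apply: K_T => //; apply: contraT => /(K_T_back q1K tT) [y yq1 q1y].
  have [_ _ yK] := crossed_mem q1K yq1; move: yq1; rewrite q1X q1y in yK *.
  by rewrite !inE => /andP[yx yX]; rewrite (Xinj y x t) ?eqxx in yx.
exists (tperm x t * q1)%g; first by rewrite groupM.
apply/setP => y; rewrite !inE permM; case: (eqVneq y x) => [->|yx].
  by rewrite tpermL q1t xT tT xX.
case: (boolP (y \in T)) => [yT|yT] /=.
  by apply/esym; apply: contraTF yT => /(subsetP XT); rewrite inE.
have ty : t != y by apply: contraNneq yT => <-.
rewrite tpermD // 1?eq_sym //; have := congr1 (fun A : {set _} => y \in A) q1X.
by rewrite !inE yx yT.
Qed.

(** Such an X contains two boxes of one column. Their transposition lies in [Kp] and preserves the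
    crossing at X, but changes the sign of g. *)
Lemma crossval_nocol X : X \subset ~: T ->
  (forall q, q \in K -> crossed q != X) -> crossval X = 0.
Proof.
move=> XT no; rewrite /crossval; case: pickP => // s cs.
have [/existsP[x /existsP[x' /existsP[t /and5P[xx' xX x'X tT /andP[xK x'K]]]]]|] :=
  boolP [exists x, exists x', exists t : 'I_n, [&& x != x', x \in X, x' \in X, t \in T &
    (tperm x t \in K) && (tperm x' t \in K)]].
  have xT : x \notin T by have := subsetP XT x xX; rewrite inE.
  have x'T : x' \notin T by have := subsetP XT x' x'X; rewrite inE.
  have cK : tperm x x' \in Kp.
    rewrite KpP; apply/andP; split.
      have := groupJ xK x'K; rewrite tpermJ tpermR tpermD //.
        by rewrite eq_sym.
      by apply: contraNneq xT => <-.
    apply/forall_inP => t' t'T; rewrite tpermD //; first by apply: contraNneq xT => ->.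
    by apply: contraNneq x'T => ->.
  have /crossvalE : crossing X (tperm x x' * s)%g.
    have /crossingP cs' := cs.
    apply/crossingP => y yT; rewrite permM; case: tpermP => [->|->|_ _]; last exact: cs'.
    + by rewrite xX; have := cs' _ x'T; rewrite x'X.
    + by rewrite x'X; have := cs' _ xT; rewrite xX.
  rewrite -(crossvalE cs) gKl // /sgn odd_tperm xx' expr1 mulN1r => /eqP.
  by rewrite eq_sym -addr_eq0 -mulr2n mulrn_eq0 => /eqP.
rewrite negb_exists => /forallP nx; have [|q qK qX] := @crossed_exists X XT.
  move=> x x' t xX x'X tT xK x'K; apply/eqP; apply: contraT => xx'.
  have := nx x; rewrite negb_exists => /forallP/(_ x'); rewrite negb_exists.
  by move/forallP/(_ t); rewrite xx' xX x'X tT xK x'K.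
by have := no q qK; rewrite qX eqxx.
Qed.

(* Each q in K is determined up to Kp by the boxes that it moves into T, and up to
   sign g depends only on these; column-repeating sets contribute 0. *)
Lemma alternating_sum : \sum_(q in K) sgn q * g q =
  #|Kp|%:R * \sum_(k < #|T|.+1) (-1) ^+ k / (k`! * #|T| ^_ k)%:R * swaps T k g 1%g.
Proof.
transitivity (#|Kp|%:R *
    \sum_(X : {set 'I_n} | X \subset ~: T) (-1) ^+ #|X| * crossval X).
  rewrite (partition_big crossed (fun X => X \subset ~: T)) => [|q _]; last first.
    by apply/subsetP => x; rewrite !inE => /andP[].
  rewrite mulr_sumr; apply: eq_bigr => X XT.
  transitivity (\sum_(q in K | crossed q == X) (-1) ^+ #|X| * crossval X).
    by apply: eq_bigr => q /andP[qK /eqP <-]; rewrite K_term.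
  rewrite sumr_const -[LHS]mulr_natl.
  have [/existsP[q0 /andP[q0K /eqP q0X]]|] := boolP [exists q in K, crossed q == X].
    rewrite -(card_crossed q0K) q0X; congr (_%:R * _).
    by apply: eq_card => q; rewrite !inE.
  rewrite negb_exists => /forallP no; rewrite crossval_nocol ?mulr0 // => q qK.
  by have := no q; rewrite qK.
congr (_ * _); rewrite [LHS](bigID (fun X : {set 'I_n} => (#|X| < #|T|.+1)%N)) /=.
rewrite [X in _ + X]big1 ?addr0 => [|X /andP[XT]]; last first.
  by rewrite -leqNgt => ?; rewrite crossval_eq0 ?mulr0.
rewrite (partition_big (fun X : {set 'I_n} => inord #|X| : 'I_#|T|.+1) predT) //=.
apply: eq_bigr => k _; have kT : (k <= #|T|)%N by rewrite -ltnS.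
rewrite (swaps_crossing k crossing1) ?sub0set // cards0 subn0 add0n.
rewrite mulrA divfK ?mulr_sumr; last first.
  by rewrite pnatr_eq0 -lt0n muln_gt0 fact_gt0 ffact_gt0.
apply: eq_big => [X|X /andP[/andP[_ lt] /eqP <-]]; last by rewrite inordK.
rewrite sub0set /= -andbA; congr (_ && _); apply/andP/eqP => [[lt /eqP<-]|->].
  by rewrite inordK.
by rewrite ltnS kT inord_val.
Qed.

End Columns.
End Crossing.

(** * Merging two rows *)

Section RowColumnSum.
Variables (C : numClosedFieldType) (r N n : nat) (B : 'I_n -> 'I_N -> C).
Implicit Types (rho : 'I_n -> 'I_r.+1) (K : {group 'S_n}) (q tau : 'S_n).

(* rho gives the row of each box and K is the group of column permutations; by
   [wick] the sum over row permutations is the scalar product of monomials. *)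
Definition rowcol_sum rho K : C :=
  \sum_(q in K) sg C q * \sum_tau dot (mono B rho tau) (mono B rho (q * tau)%g).

Lemma rowcol_sumE rho K : rowcol_sum rho K =
  \sum_(q in K) sg C q * \sum_(tau : 'S_n) \sum_(p : 'S_n) \prod_x
    (if rho x == rho (p x) then ip (B (tau x)) (B (tau (q (p x)))) else 0).
Proof.
apply: eq_bigr => q _; congr (_ * _); apply: eq_bigr => tau _.
rewrite /mono wick; apply: eq_bigr => p _; apply: eq_bigr => x _.
by rewrite permM.
Qed.

Lemma eq_rowcol_sum rho rho' K :
  (forall x y, (rho x == rho y) = (rho' x == rho' y)) ->
  rowcol_sum rho K = rowcol_sum rho' K.
Proof.
move=> e; rewrite !rowcol_sumE; apply: eq_bigr => q _; congr (_ * _).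
apply: eq_bigr => tau _; apply: eq_bigr => p _; apply: eq_bigr => x _.
by rewrite e.
Qed.

Lemma sgM q tau : sg C (q * tau)%g = sg C q * sg C tau.
Proof. by rewrite /sg odd_permM signr_addb. Qed.

Lemma sgV q : sg C q^-1%g = sg C q.
Proof. by rewrite /sg odd_permV. Qed.

Lemma sgK q : sg C q * sg C q = 1.
Proof. by rewrite /sg -signr_addb addbb. Qed.

Lemma sg_conj q : (sg C q)^* = sg C q.
Proof. by rewrite /sg; case: (odd_perm q); rewrite ?expr1 ?expr0 ?rmorphN1 ?conjC1. Qed.

(** The substitution of c' q c^-1 for q absorbs both antisymmetrizations together with their
    signs. *)
Lemma rowcol_sum_bidet rho K (Kp : {group 'S_n}) : Kp \subset K ->
  \sum_(q in K) sg C q * \sum_tau dot (bidet B rho Kp tau) (bidet B rho Kp (q * tau)%g)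
  = #|Kp|%:R ^+ 2 * rowcol_sum rho K.
Proof.
move=> sK.
pose h q := \sum_tau dot (mono B rho tau) (mono B rho (q * tau)%g).
transitivity (\sum_(q in K) \sum_(c in Kp) \sum_(c' in Kp)
    sg C (c' * q * c^-1)%g * h (c' * q * c^-1)%g).
  apply: eq_bigr => q _; rewrite mulr_sumr.
  transitivity (\sum_tau \sum_(c in Kp) \sum_(c' in Kp) sg C (c' * q * c^-1)%g *
     dot (mono B rho (c * tau)%g) (mono B rho (c' * q * tau)%g)).
    apply: eq_bigr => tau _; rewrite /bidet dot_suml mulr_sumr; apply: eq_bigr => c _.
    rewrite dot_sumr mulr_sumr; apply: eq_bigr => c' _.
    by rewrite dotZl dotZr sg_conj !sgM sgV !mulgA; ring.
  rewrite exchange_big /=; apply: eq_bigr => c _; rewrite exchange_big /=.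
  apply: eq_bigr => c' _; rewrite -mulr_sumr; congr (_ * _).
  rewrite (reindex_inj (mulgI c^-1%g)) /=; apply: eq_bigr => tau _.
  by rewrite mulKVg mulgA.
rewrite exchange_big /=; under eq_bigr => c _ do rewrite exchange_big /=.
transitivity (\sum_(c in Kp) \sum_(c' in Kp) rowcol_sum rho K).
  apply: eq_bigr => c cK; apply: eq_bigr => c' c'K.
  have [cKK c'KK] := (subsetP sK _ (groupVr cK), subsetP sK _ c'K).
  rewrite /rowcol_sum [RHS](big_mulgl (K := K) _ c'KK) [RHS](big_mulgr (K := K) _ cKK).
  by apply: eq_bigr => q _; rewrite mulgA.
by rewrite !sumr_const expr2 -mulrA mulr_natl mulr_natl.
Qed.

Lemma bidet_mul rho (Kp : {group 'S_n}) c tau : c \in Kp ->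
  bidet B rho Kp (c * tau)%g = sg C c *: bidet B rho Kp tau.
Proof.
move=> cK; rewrite /bidet [in RHS](big_mulgr (K := Kp) _ cK) scaler_sumr.
apply: eq_bigr => c' _; rewrite scalerA sgM mulgA.
by rewrite mulrC -mulrA sgK mulr1.
Qed.

Lemma rowcol_sum_norm rho (Kp : {group 'S_n}) :
  #|Kp|%:R * rowcol_sum rho Kp =
  \sum_tau dot (bidet B rho Kp tau) (bidet B rho Kp tau).
Proof.
have KpN0 : #|Kp|%:R != 0 :> C by rewrite pnatr_eq0 -lt0n cardG_gt0.
apply: (mulfI KpN0); rewrite mulrA -expr2 -rowcol_sum_bidet //.
rewrite (eq_bigr (fun=> \sum_tau dot (bidet B rho Kp tau) (bidet B rho Kp tau))).
  by rewrite sumr_const mulr_natl.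
move=> c cK; rewrite mulr_sumr; apply: eq_bigr => tau _.
by rewrite bidet_mul // dotZr sg_conj mulrA sgK mul1r.
Qed.

End RowColumnSum.

Section Step.
Variables (C : numClosedFieldType) (r N n : nat) (B : 'I_n -> 'I_N -> C).
Variables (rho : 'I_n -> 'I_r.+1) (K Kp : {group 'S_n}) (s : 'I_r.+1) (O : seq 'I_r.+1).
Let T := [set x | rho x == ord0].
Let a := #|T|.
Hypotheses (O_uniq : uniq O) (sO : s \notin O) (s0 : s != ord0) (O0 : ord0 \notin O).
Hypothesis rhoQ : forall x, rho x != ord0 -> rho x \in s :: O.
Hypothesis K_T : forall q t, q \in K -> t \in T -> q t \in T -> q t = t.
Hypothesis K_col : forall x, x \notin T -> exists2 t, t \in T & tperm x t \in K.
Hypothesis KpP : forall c, (c \in Kp) = (c \in K) && [forall t in T, c t == t].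
Hypothesis K_up : forall i j y, i \in s :: O -> j \in O -> i != j -> rho y = j ->
  exists2 y', rho y' = i & tperm y y' \in K.
Implicit Types (tau q c h : 'S_n) (i j : 'I_r.+1).

Let KpT c t : c \in Kp -> t \in T -> c t = t.
Proof. by rewrite KpP => /andP[_ /forall_inP cT] /cT/eqP. Qed.

Let bd := bidet B rho Kp.
Let mx := mixed B rho Kp.

Let Q0 : all (fun i => i != ord0) (s :: O).
Proof. by rewrite /= s0; apply/allP => i; apply: contraTneq => ->. Qed.

Let Q_uniq : uniq (s :: O).
Proof. by rewrite /= sO. Qed.

Lemma bidet_fixC h tau : fixC T h -> bd (h * tau)%g = bd tau.
Proof.
move=> hT; rewrite /bd !(bidet_split B KpT); congr (_ * _).
  rewrite /topf [RHS](reindex_inj (@perm_inj _ h)) /=.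
  apply: eq_big => [t|t _]; first by rewrite fixC_T.
  by rewrite permM.
apply: eq_bigr => c _; congr (_ *: _); apply: eq_bigr => x.
by rewrite inE permM => /hT ->.
Qed.

Let g q : C := \sum_tau dot (bd tau) (bd (q^-1 * tau)%g).

Let gl h q : fixC T h -> g (h * q)%g = g q.
Proof.
move=> hT; rewrite /g (reindex_inj (mulgI h)) /=; apply: eq_bigr => tau _.
by rewrite invMg mulgA mulgKV bidet_fixC.
Qed.

Let gr h q : fixC T h -> g (q * h)%g = g q.
Proof.
move=> hT; rewrite /g; apply: eq_bigr => tau _; rewrite invMg -mulgA bidet_fixC //.
by move=> x xT; apply: (@perm_inj _ h); rewrite permKV hT.
Qed.

Let gKl c q : c \in Kp -> g (c * q)%g = sg C c * g q.
Proof.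
move=> cK; rewrite /g (reindex_inj (mulgI c)) mulr_sumr /=; apply: eq_bigr => tau _.
by rewrite invMg mulgA mulgKV /bd bidet_mul // dotZl.
Qed.

Let gKr c q : c \in Kp -> g (q * c)%g = sg C c * g q.
Proof.
move=> cK; rewrite /g mulr_sumr; apply: eq_bigr => tau _.
by rewrite invMg -mulgA /bd bidet_mul ?groupV // dotZr sg_conj sgV.
Qed.

Lemma rowcol_sum_contract : #|Kp|%:R * rowcol_sum B rho K =
  \sum_(k < a.+1) (-1) ^+ k / (k`! * a ^_ k)%:R *
     \sum_tau contract (s :: O) k (mx tau).
Proof.
have KpN0 : #|Kp|%:R != 0 :> C by rewrite pnatr_eq0 -lt0n cardG_gt0.
have sK : Kp \subset K by apply/subsetP => c; rewrite KpP => /andP[].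
apply: (mulfI KpN0); rewrite mulrA -expr2 -rowcol_sum_bidet //.
rewrite (big_invg K).
transitivity (\sum_(q in K) (-1) ^+ odd_perm q * g q).
  by apply: eq_bigr => q _; rewrite sgV.
rewrite (alternating_sum gl gr K_T K_col KpP gKl gKr); congr (_ * _).
apply: eq_bigr => k _; congr (_ * _); rewrite -swaps_sum; apply: eq_bigr => tau _.
by rewrite (contract_mixed B Q_uniq Q0 rhoQ KpT).
Qed.

(** The merged row is labelled s, as in [neuberger_norm]: this frees the variables of row 0 for the
    contractions. *)
Let rho' x := if rho x == ord0 then s else rho x.

Lemma merge_norm : #|Kp|%:R * rowcol_sum B rho' Kp =
  \sum_(k < a.+1) \sum_tau
     dot (iter k (lap s) (mx tau)) (iter k (lap s) (mx tau)) / (k`!%:R ^+ 2).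
Proof.
rewrite rowcol_sum_norm exchange_big; apply: eq_bigr => tau _ /=.
pose l := [seq B (tau t) | t <- enum T].
have lE i : lfs l i = \prod_(t in T) lf (B (tau t)) i.
  by rewrite /lfs big_map big_enum.
have -> : bidet B rho' Kp tau = lfs l s * bidetS B rho Kp tau.
  rewrite /bidet /bidetS mulr_sumr (big_invg Kp); apply: eq_bigr => c cK.
  rewrite -scalerAr monoM sgV invgK lE; congr (_ *: _).
  rewrite (bigID (mem T)) /=; congr (_ * _).
    apply: eq_bigr => x xT; rewrite (KpT cK xT).
    by move: xT; rewrite inE /rho' => /eqP->; rewrite eqxx.
  apply: eq_big => [x|x xT]; first by rewrite !inE.
  have := Kp_T KpT x cK; rewrite (negPf xT) /rho' inE => ->.
  by [].
rewrite (neuberger_norm s0 l (bidetS_free _ KpT _)).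
by rewrite size_map -cardE lE.
Qed.

Lemma pol_bidetS i j tau : i != ord0 -> j != ord0 ->
  pol i j (bidetS B rho Kp tau) = \sum_(y | rho y == j) \sum_(c in Kp)
    sg C c *: word_prod (fun x => B (tau x)) (~: T)
       (fun x => if c x == y then i else rho (c x)).
Proof.
move=> i0 j0; rewrite /bidetS (linear_sum (pol i j)) [RHS]exchange_big /=.
apply: eq_bigr => c cK.
rewrite linearZ /= pol_word_prod -scaler_sumr; congr (_ *: _).
rewrite [RHS](reindex_inj (@perm_inj _ c)) /=. apply: eq_big => [x|x _].
  rewrite andb_idl // => /eqP e; rewrite inE -(Kp_T KpT x cK) inE e.
  by rewrite (negPf j0).
by apply: eq_word_prod => y _; rewrite (inj_eq perm_inj).
Qed.

Lemma pol_bidetS_diag i tau : i != ord0 ->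
  pol i i (bidetS B rho Kp tau) = #|[set x | rho x == i]|%:R *: bidetS B rho Kp tau.
Proof.
move=> i0; rewrite pol_bidetS // (eq_bigr (fun=> bidetS B rho Kp tau)).
  by rewrite sumr_const scaler_nat cardsE.
move=> y /eqP yi; apply: eq_bigr => c _; congr (_ *: _).
by apply: eq_word_prod => x _; case: eqP => // ->.
Qed.

(** Relabelling a box y of row j by i gives two boxes of one column the same label, and the
    antisymmetrization over [Kp] kills the result. *)
Lemma pol_bidetS_off i j tau : i \in s :: O -> j \in O -> i != j ->
  pol i j (bidetS B rho Kp tau) = 0.
Proof.
move=> iQ jO ij.
have i0 : i != ord0 by apply: (allP Q0).
have j0 : j != ord0 by apply: (allP Q0); rewrite inE jO orbT.
rewrite pol_bidetS // big1 // => y /eqP yj.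
have [y' y'i yK] := K_up iQ jO ij yj; set S := \sum_(c in Kp) _.
have yy' : y != y' by apply: contraNneq ij => e; rewrite -y'i -e yj.
have tK : tperm y y' \in Kp.
  rewrite KpP yK; apply/forall_inP => t; rewrite inE => /eqP t0.
  by rewrite tpermD //; apply/eqP => e; [move: j0; rewrite -yj|move: i0; rewrite -y'i]; rewrite e t0.
have SN : S = - S.
  rewrite {1}/S (big_mulgr (K := Kp) _ tK) -sumrN; apply: eq_bigr => c _.
  rewrite sgM {2}/sg odd_tperm yy' expr1 mulrN1 scaleNr; congr (- (_ *: _)).
  apply: eq_word_prod => x _; rewrite permM.
  case: (tpermP y y' (c x)) => [->|->|/eqP xy /eqP xy'].
  - by rewrite eqxx eq_sym (negPf yy').
  - by rewrite eqxx eq_sym (negPf yy').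
  - by rewrite (negPf xy).
apply/eqP; move/eqP: SN; rewrite -addr_eq0 -mulr2n -scaler_nat.
by rewrite scaler_eq0 pnatr_eq0.
Qed.

Lemma pol_mixed i j tau : i != ord0 -> j != ord0 ->
  pol i j (mx tau) = topf B rho tau * cj (pol i j (bidetS B rho Kp tau)).
Proof.
move=> i0 j0; rewrite /mx /mixed polM -cj_pol [X in X * _ + _](_ : _ = 0).
  by rewrite mul0r add0r.
by rewrite /pol big1 // => e _; rewrite (topf_only B rho) // mulr0.
Qed.

Lemma pol_mixed_diag i tau : i != ord0 ->
  pol i i (mx tau) = #|[set x | rho x == i]|%:R *: mx tau.
Proof.
by move=> i0; rewrite pol_mixed // pol_bidetS_diag // cjZ conjC_nat -scalerAr.
Qed.

Lemma pol_mixed_off i j tau : i \in s :: O -> j \in O -> i != j ->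
  pol i j (mx tau) = 0.
Proof.
move=> iQ jO ij; have i0 : i != ord0 by apply: (allP Q0).
have j0 : j != ord0 by apply: (allP Q0); rewrite inE jO orbT.
by rewrite pol_mixed // pol_bidetS_off // cj0 mulr0.
Qed.

Lemma pol_mixed_ord0 tau : pol ord0 ord0 (mx tau) = a%:R *: mx tau.
Proof.
pose l := [seq B (tau t) | t <- enum T].
have -> : mx tau = lfs l ord0 * cj (bidetS B rho Kp tau).
  by rewrite /mx /mixed /topf /lfs big_map big_enum.
by rewrite pol00_lfs ?size_map -?cardE //; apply: (bidetS_free _ KpT).
Qed.

Variables (b c : nat).
Hypothesis card_s : #|[set x | rho x == s]| = b.
Hypothesis card_O : forall i, i \in O -> #|[set x | rho x == i]| = c.
Hypothesis shape : [\/ O = [::], [/\ c = 3, size O = 1%N, b = 3 & (2 < a)%N] |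
                       [/\ c = 3, size O = 2 & (3 < b < a)%N]].

Theorem rowcol_sum_merge :
  rowcol_sum B rho K <= rowcol_sum B rho' Kp.
Proof.
have Kp0 : 0 < #|Kp|%:R :> C by rewrite ltr0n cardG_gt0.
rewrite -(ler_pM2l Kp0) rowcol_sum_contract merge_norm; apply: ler_sum => k _.
rewrite mulr_sumr; apply: ler_sum => tau _.
have ka : (k <= a)%N by rewrite -ltnS.
have k0 : 0 < k`!%:R :> C by rewrite ltr0n fact_gt0.
have f0 : 0 < (a ^_ k)%:R :> C by rewrite ltr0n ffact_gt0.
have lhs0 : 0 <= contract (s :: O) k (mx tau).
  by apply: sumr_ge0 => w _; apply: dot_ge0.
have [odd_k|even_k] := boolP (odd k).
  (* Odd terms are nonpositive on the left and nonnegative on the right. *)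
  apply: (@le_trans _ _ 0); last first.
    by rewrite divr_ge0 ?dot_ge0 // exprn_ge0 // ltW.
  by rewrite -signr_odd odd_k expr1 mulNr mul1r mulNr oppr_le0 mulr_ge0 // invr_ge0 ler0n.
rewrite -signr_odd (negPf even_k) expr0 mul1r natrM mulrC ler_pdivrMr ?mulr_gt0 //.
have bin_a : 'C(a, k)%:R = (a ^_ k)%:R / k`!%:R :> C.
  by rewrite -bin_ffact natrM mulfK // gt_eqF.
have := @contract_le _ _ _ s O O_uniq sO s0 O0 a b c (mx tau) _ _ _ _ _ k even_k shape.
rewrite bin_a; set D := dot _ _.
have -> : D / k`!%:R ^+ 2 * (k`!%:R * (a ^_ k)%:R) = (a ^_ k)%:R / k`!%:R * D.
  by field; rewrite gt_eqF.
apply.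
- by move=> i iO; rewrite pol_mixed_diag ?card_O //; apply: (allP Q0); rewrite inE iO orbT.
- by move=> i j iO jO ij; rewrite pol_mixed_off // inE iO orbT.
- by move=> i iO; rewrite pol_mixed_off ?mem_head //; apply: contraNneq sO => ->.
- by rewrite pol_mixed_diag // card_s.
- exact: pol_mixed_ord0.
Qed.

End Step.

(** * The chain of merges *)

Lemma hermitian_psd_gram (C : numClosedFieldType) n (A : 'M[C]_n) :
  hermitian_psd A ->
  exists B : 'I_n -> 'I_n -> C, forall x y, A x y = ip (B x) (B y).
Proof.
move=> [A_herm A_psd]; have /orthomx_spectralP := hermitian_normalmx A_herm.
set P := spectralmx A; set d := spectral_diag A => AE.
have P_unitary : P \is unitarymx := spectral_unitarymx A.
rewrite (invmx_unitary P_unitary) in AE.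
have PAP : P *m A *m (P ^t* )%sesqui = diag_mx d.
  have /unitarymxP PP := P_unitary.
  by rewrite AE !mulmxA PP mul1mx -mulmxA PP mulmx1.
have d_ge0 k : 0 <= d 0 k.
  have := A_psd ((row k P) ^t* )%sesqui.
  suff -> : d 0 k = (row k P *m A *m ((row k P) ^t* )%sesqui) 0 0.
    by rewrite -map_trmx map_mxCK trmxK.
  have -> : d 0 k = diag_mx d k k by rewrite mxE eqxx.
  rewrite -PAP -row_mul [LHS]mxE [RHS]mxE; apply: eq_bigr => j _.
  by rewrite !mxE.
exists (fun x k => sqrtC (d 0 k) * (P k x)^*) => x y.
rewrite AE mxE; apply: eq_bigr => k _.
rewrite mul_mx_diag !mxE rmorphM /= conjCK.
have -> : (sqrtC (d 0 k))^* = sqrtC (d 0 k).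
  by apply: CrealP; rewrite ger0_real // sqrtC_ge0.
by rewrite mulrACA -expr2 sqrtCK mulrA; congr (_ * _); rewrite mulrC.
Qed.

Section Assembly.
Variables (C : numClosedFieldType) (r n : nat) (la : seq nat) (A : 'M[C]_n).
Hypothesis la_n : sumn la = n.
Variable B : 'I_n -> 'I_n -> C.
Hypothesis AE : forall x y, A x y = ip (B x) (B y).

Lemma rowcol_sum_immanant (rho : 'I_n -> 'I_r.+1) (K : {group 'S_n}) :
  (forall x y, (rho x == rho y) = (reshape_index la x == reshape_index la y)) ->
  K = col_stab n la :> {set 'S_n} ->
  rowcol_sum B rho K = normalized_immanant la A * n`!%:R.
Proof.
move=> rhoE KE; rewrite normalized_immanantE // rowcol_sumE KE.
under [RHS]eq_bigr => g _ do rewrite exchange_big /=.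
rewrite [RHS]exchange_big /=; apply: eq_bigr => q _.
rewrite mulr_sumr; apply: eq_bigr => g _; rewrite mulr_sumr.
rewrite [RHS]big_mkcond; apply: eq_bigr => p _.
have [/row_stabP pR|] := boolP (p \in row_stab n la).
  by congr (_ * _); apply: eq_bigr => x _; rewrite rhoE pR eqxx AE.
rewrite inE negb_forall => /existsP[x xp].
apply/eqP; rewrite mulf_eq0 prodf_seq_eq0 /=; apply/orP; right; apply/hasP; exists x.
  by rewrite mem_index_enum.
by rewrite rhoE [reshape_index _ _ == _]eq_sym (negPf xp) eqxx.
Qed.

Lemma rowcol_sum_permanent (rho : 'I_n -> 'I_r.+1) (K : {group 'S_n}) :
  (forall x y, rho x = rho y) -> K = 1%g :> {set 'S_n} ->
  rowcol_sum B rho K = permanent A * n`!%:R.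
Proof.
move=> rhoE KE; rewrite rowcol_sumE KE big_set1 /sg odd_perm1 mul1r.
rewrite (eq_bigr (fun=> permanent A)) => [|g _].
  by rewrite sumr_const card_Sn mulr_natr.
rewrite /permanent [RHS](reindex_inj (conjg_inj g)) /=; apply: eq_bigr => p _.
rewrite [RHS](reindex_inj (@perm_inj _ g)) /=; apply: eq_bigr => x _.
by rewrite (rhoE x (p x)) eqxx AE perm1 permJ.
Qed.

End Assembly.

(** * Merged rows of a fixed tableau *)

Section RowMerging.
Variables (n : nat) (la : seq nat).
Hypothesis la_n : sumn la = n.
Implicit Types (j k : nat) (x y t : 'I_n) (q : 'S_n).

Lemma card_row k : #|[set x : 'I_n | reshape_index la x == k]| = nth 0%N la k.
Proof.
have box (c : 'I_(nth 0%N la k)) : (flatten_index la k c < n)%N.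
  by rewrite -la_n; apply: flatten_indexP.
pose f c := Ordinal (box c).
have f_inj : injective f.
  move=> c c' /(congr1 (fun x : 'I_n => reshape_offset la x)) /=.
  by rewrite !flatten_indexKr // => /val_inj.
rewrite -[RHS]card_ord -(card_imset _ f_inj); apply: eq_card => x.
rewrite inE; apply/eqP/imsetP => [xk|[c _ ->]].
  have lt : (reshape_offset la x < nth 0%N la k)%N by rewrite -xk box_lt.
  exists (Ordinal lt) => //; apply: val_inj.
  by rewrite /= -xk reshape_indexK.
by rewrite /= flatten_indexKl.
Qed.

Definition col_group : {group 'S_n} := Group (col_stab_group n la).

Definition upper_rows j := [set x : 'I_n | (reshape_index la x < j)%N].

(** The boxes of merged rows stay in the diagram. Those of index less than j are fixed, as if alone
    in their columns, and row j supplies the tops of the columns; so [col_fix j] goes with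
    [merged j.+1], in which row j already belongs to row 0. *)
Definition col_fix j : {group 'S_n} := ('C_col_group(upper_rows j | 'P))%G.

Lemma col_fixP j q : reflect
  ((forall x, reshape_offset la (q x) = reshape_offset la x) /\
   (forall x, (reshape_index la x < j)%N -> q x = x)) (q \in col_fix j).
Proof.
rewrite inE; apply: (iffP andP) => [[/col_stabP qC /astabP qT]|[qC qT]].
  by split => // x xj; apply: (qT x); rewrite inE.
split; first exact/col_stabP.
by apply/astabP => x; rewrite inE => /qT.
Qed.

Lemma col_fix_tperm j x y : reshape_offset la x = reshape_offset la y ->
  (j <= reshape_index la x)%N -> (j <= reshape_index la y)%N ->
  tperm x y \in col_fix j.
Proof.
move=> exy xj yj; apply/col_fixP; split=> z.
  by case: tpermP => [->|->|].
by case: tpermP => // -> lt; [move: xj|move: yj]; rewrite leqNgt lt.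
Qed.

Lemma col_fixS j q :
  (q \in col_fix j.+1) = (q \in col_fix j) && [forall t in upper_rows j.+1, q t == t].
Proof.
apply/col_fixP/andP => [[qC qT]|[/col_fixP[qC _] /forall_inP qT]].
  split; first by apply/col_fixP; split => // x xj; apply: qT; rewrite ltnW.
  by apply/forall_inP => t; rewrite inE => /qT/eqP.
by split => // x xj; apply/eqP/qT; rewrite inE.
Qed.

Lemma col_fix_upper j q t : q \in col_fix j ->
  t \in upper_rows j.+1 -> q t \in upper_rows j.+1 -> q t = t.
Proof.
move=> /col_fixP[qC qT]; rewrite !inE !ltnS => tj qtj.
have [/qT //|jt] := ltnP (reshape_index la t) j.
have [/qT/perm_inj //|jqt] := ltnP (reshape_index la (q t)) j.
apply: (box_inj (la := la)); last exact: qC.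
by apply: anti_leq; rewrite (leq_trans tj) // (leq_trans qtj).
Qed.

Variable r : nat.
Hypotheses (la_sorted : sorted geq la) (la_size : (size la <= r.+1)%N).

Lemma row_lt x : (reshape_index la x < r.+1)%N.
Proof.
apply: leq_trans la_size; rewrite ltnNge; apply/negP => le.
by have := box_lt la_n x; rewrite nth_default.
Qed.

Lemma row_le i k : (i <= k)%N -> (nth 0%N la k <= nth 0%N la i)%N.
Proof.
move=> ik; have [kl|lk] := ltnP k (size la); last by rewrite nth_default.
have := sorted_leq_nth (rev_trans leq_trans) leqnn 0%N la_sorted.
by apply => //; rewrite inE // (leq_ltn_trans ik).
Qed.

Definition merged j x : 'I_r.+1 :=
  if (reshape_index la x < j)%N then ord0 else inord (reshape_index la x).

Lemma inord_inj i k : (i <= r)%N -> (k <= r)%N ->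
  (inord i == inord k :> 'I_r.+1) = (i == k).
Proof. by move=> ir kr; rewrite -(inj_eq val_inj) /= !inordK. Qed.

Lemma merged_inord j x i : (j < i <= r)%N ->
  (merged j.+1 x == inord i) = (reshape_index la x == i).
Proof.
move=> /andP[ji ir]; rewrite /merged ltnS; case: leqP => [xj|jx].
  have -> : ord0 = inord 0 :> 'I_r.+1 by apply: val_inj; rewrite /= inordK.
  by rewrite inord_inj // !ltn_eqF // ?(leq_trans _ ji).
by rewrite inord_inj // -ltnS row_lt.
Qed.

Lemma merged_ord0 j x : (merged j.+1 x == ord0) = (reshape_index la x < j.+1)%N.
Proof.
rewrite /merged; case: ltnP => // jx.
have -> : ord0 = inord 0 :> 'I_r.+1 by apply: val_inj; rewrite /= inordK.
by rewrite inord_inj -1?ltnS ?row_lt // gtn_eqF // (leq_trans _ jx).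
Qed.

Lemma merged1E x y :
  (merged 1 x == merged 1 y) = (reshape_index la x == reshape_index la y).
Proof.
have inord_row z : merged 1 z = inord (reshape_index la z).
  rewrite /merged ltnS leqn0; case: eqP => // ->.
  by apply: val_inj; rewrite /= inordK.
by rewrite !inord_row inord_inj // -ltnS row_lt.
Qed.

Lemma merged_all x y : merged r.+1 x = merged r.+1 y.
Proof. by rewrite /merged !row_lt. Qed.

Lemma col_fix0 : col_fix 0 = col_stab n la :> {set 'S_n}.
Proof.
by apply/setP => q; apply/col_fixP/col_stabP => [[]|].
Qed.

Lemma col_fix_last : col_fix r = 1%g :> {set 'S_n}.
Proof.
apply/trivgP/subsetP => q qK; rewrite inE; apply/eqP/permP => x; rewrite perm1.
by apply: (col_fix_upper qK); rewrite inE row_lt.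
Qed.

Variables (C : numClosedFieldType) (N : nat) (B : 'I_n -> 'I_N -> C).

Lemma rowcol_sum_merge_step j c : (j < r)%N ->
  (forall i, (j.+1 < i <= r)%N -> nth 0%N la i = c) ->
  let b := nth 0%N la j.+1 in let a := #|upper_rows j.+1| in
  [\/ r = j.+1, [/\ c = 3, r = j.+2, b = 3 & (2 < a)%N] |
      [/\ c = 3, r = j.+3 & (3 < b < a)%N]] ->
  rowcol_sum B (merged j.+1) (col_fix j) <=
  rowcol_sum B (merged j.+2) (col_fix j.+1).
Proof.
move=> jr tail b a shape.
pose s : 'I_r.+1 := inord j.+1.
pose O : seq 'I_r.+1 := [seq inord i | i <- iota j.+2 (r - j.+1)].
have OP i : reflect (exists2 k, (j.+1 < k <= r)%N & i = inord k) (i \in O).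
  apply: (iffP mapP) => -[k kk ->]; exists k => //; move: kk;
  by rewrite mem_iota; lia.
have QP i : reflect (exists2 k, (j < k <= r)%N & i = inord k) (i \in s :: O).
  rewrite inE; apply: (iffP orP) => [[/eqP->|/OP[k kk ->]]|[k kk ->]].
  - by exists j.+1; rewrite ?ltnSn.
  - by exists k => //; lia.
  - have [->|kj] := eqVneq k j.+1; first by left.
    by right; apply/OP; exists k => //; lia.
have inord0 k : (0 < k <= r)%N -> inord k != ord0 :> 'I_r.+1.
  move=> /andP[k0 kr]; have -> : ord0 = inord 0 :> 'I_r.+1.
    by apply: val_inj; rewrite /= inordK.
  by rewrite inord_inj // -lt0n.
have TE : [set x | merged j.+1 x == ord0] = upper_rows j.+1.
  by apply/setP => x; rewrite !inE merged_ord0.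
have O_uniq : uniq O.
  rewrite map_inj_in_uniq ?iota_uniq // => i k; rewrite !mem_iota => ii kk /eqP.
  by rewrite inord_inj; [move/eqP | lia | lia].
have sO : s \notin O.
  by apply/OP => -[k kk /eqP]; rewrite inord_inj; [move/eqP | lia | lia]; lia.
have s0 : s != ord0 by apply: inord0; lia.
have O0 : ord0 \notin O.
  by apply/OP => -[k kk /eqP]; rewrite eq_sym; apply/negP/inord0; lia.
have rowQ x : merged j.+1 x != ord0 -> merged j.+1 x \in s :: O.
  rewrite merged_ord0 -leqNgt => jx; apply/QP; exists (reshape_index la x).
    by rewrite jx -ltnS row_lt.
  by rewrite /merged ltnNge jx.
have K_T q t : q \in col_fix j -> t \in [set x | merged j.+1 x == ord0] ->
    q t \in [set x | merged j.+1 x == ord0] -> q t = t.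
  by rewrite TE; apply: col_fix_upper.
have K_col x : x \notin [set x | merged j.+1 x == ord0] ->
    exists2 t, t \in [set x | merged j.+1 x == ord0] & tperm x t \in col_fix j.
  rewrite TE inE -leqNgt => jx.
  have lt : (reshape_offset la x < nth 0%N la j)%N.
    by rewrite (leq_trans (box_lt la_n x)) // row_le // ltnW.
  have [t [tj tx]] := box_ex la_n lt; exists t; first by rewrite inE tj.
  by rewrite col_fix_tperm ?tx ?tj // ltnW.
have KpP q : (q \in col_fix j.+1) = (q \in col_fix j) &&
    [forall t in [set x | merged j.+1 x == ord0], q t == t].
  by rewrite TE col_fixS.
(* Row i has a box in the column of y: a row above that of y is at least as long, and a row below it
   has the same length c. *)
have K_up (i k : 'I_r.+1) y : i \in s :: O -> k \in O -> i != k -> merged j.+1 y = k ->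
    exists2 y', merged j.+1 y' = i & tperm y y' \in col_fix j.
  move=> /QP[i' ii ->] /OP[k' kk ->] _ /eqP.
  rewrite merged_inord => [/eqP yk|]; last by lia.
  have lt : (reshape_offset la y < nth 0%N la i')%N.
    rewrite (leq_trans (box_lt la_n y)) // yk.
    have [|] := leqP i' k'; first exact: row_le.
    by move=> ki; rewrite !tail //; lia.
  have [t [ti ty]] := box_ex la_n lt; exists t.
    by apply/eqP; rewrite merged_inord // ti.
  by rewrite col_fix_tperm ?ty ?ti ?yk //; lia.
have card_s : #|[set x | merged j.+1 x == s]| = b.
  rewrite /b -card_row; apply: eq_card => x; rewrite !inE merged_inord //; lia.
have card_O i : i \in O -> #|[set x | merged j.+1 x == i]| = c.
  move=> /OP[k kk ->]; rewrite -(tail k) // -card_row; apply: eq_card => x.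
  by rewrite !inE merged_inord //; lia.
have size_O : size O = (r - j.+1)%N by rewrite size_map size_iota.
have hyp : [\/ O = [::], [/\ c = 3, size O = 1%N, b = 3
      & (2 < #|[set x | merged j.+1 x == ord0]|)%N]
    | [/\ c = 3, size O = 2 & (3 < b < #|[set x | merged j.+1 x == ord0]|)%N]].
  rewrite TE size_O; case: shape => [e|[? e ? ?]|[? e ?]].
  - by apply: Or31; apply: size0nil; rewrite size_O e subnn.
  - by apply: Or32; split => //; lia.
  - by apply: Or33; split => //; lia.
have := rowcol_sum_merge B O_uniq sO s0 O0 rowQ K_T K_col KpP K_up card_s card_O hyp.
congr (_ <= _); apply: eq_rowcol_sum => x y.
(* The two labellings name the merged row differently, s and 0, but have the same fibres, which is
   all that [rowcol_sum] sees. *)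
have maxE z : (if merged j.+1 z == ord0 then s else merged j.+1 z)
    = inord (maxn j.+1 (reshape_index la z)).
  rewrite merged_ord0 /merged; by case: ltnP.
have max_le (z : 'I_n) : (maxn j.+1 (reshape_index la z) <= r)%N.
  by rewrite geq_max jr /= -ltnS row_lt.
rewrite !maxE inord_inj //; have [lt|ge] := ltnP (reshape_index la y) j.+2.
  move: (merged_ord0 j.+1 x); rewrite {3}/merged lt => ->; lia.
rewrite {2}/merged ltnNge ge /= merged_inord; [lia|].
by rewrite ge -ltnS row_lt.
Qed.

End RowMerging.

Local Open Scope complex_scope.

Theorem theorem1p4 (R : realType) (a b : nat)
    (hb : (4 <= b)%N) (hab : (b <= a)%N) (h58 : (8 * b <= 5 * a)%N)
    (A : 'M[R[i]]_(a + b + 6)) (hA : hermitian_psd A) :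
  normalized_immanant [:: a; b; 3; 3]%N A <= permanent A.
Proof.
have [B AE] := hermitian_psd_gram hA.
set n := (a + b + 6)%N in A hA B AE *; pose la := [:: a; b; 3; 3]%N.
have la_n : sumn la = n by rewrite /la /n /=; lia.
have la_sorted : sorted geq la by rewrite /= hab /= !andbT; lia.
have la_size : (size la <= 4)%N by [].
have fact0 : 0 < n`!%:R :> R[i] by rewrite ltr0n fact_gt0.
rewrite -(ler_pM2r fact0).
rewrite -(rowcol_sum_immanant la_n AE (merged1E la_n la_size) (col_fix0 n la)).
rewrite -(rowcol_sum_permanent AE (merged_all la_n la_size) (col_fix_last la_n la_size)).
have upper_rows1 : (a <= #|upper_rows n la 1|)%N.
  rewrite -[X in (X <= _)%N]/(nth 0%N la 0) -(card_row la_n); apply: subset_leq_card.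
  by apply/subsetP => x; rewrite !inE => /eqP->.
have upper_rows2 : (a <= #|upper_rows n la 2|)%N.
  apply: leq_trans upper_rows1 _; apply: subset_leq_card.
  by apply/subsetP => x; rewrite !inE => /ltnW.
have step := rowcol_sum_merge_step la_n la_sorted la_size B.
apply: le_trans (le_trans (step 0%N 3%N isT _ _) (step 1%N 3%N isT _ _)) _.
- by case=> [|[|[|[|i]]]].
(* The strict inequality b < a comes from 8b <= 5a and b >= 4. *)
- by apply: Or33; split => //=; rewrite hb (leq_trans _ upper_rows1) //; lia.
- by case=> [|[|[|[|i]]]].
- by apply: Or32; split => //=; rewrite (leq_trans _ upper_rows2) //; lia.
apply: (step 2%N 3%N isT); first by case=> [|[|[|[|i]]]].
exact: Or31.
Qed.
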